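(* Let $V \xrightarrow{R} \mathfrak{g}$ be an rRB Leibniz algebra with Leibniz bracket $\mu_\mathfrak{g}$ on $\mathfrak{g}$ and representation $(V,l_V,r_V)$, let $\pi=\mu_\mathfrak{g}+l_V+r_V\in(L')_1$, and let $\theta=(\pi[1],R)\in(L'[1]\oplus\mathfrak{a})_0$ be the corresponding Maurer-Cartan element in the $L_\infty$-algebra $(L'[1]\oplus\mathfrak{a},\{l_k\}_{k\ge1})$. Then: (i) There is an $L_\infty$-algebra $(L'[1]\oplus\mathfrak{a},\{l_k^{(\pi[1],R)}\}_{k\ge1})$, where for $k\ge1$ $$l_k^{(\pi[1],R)}\big((x_1[1],a_1),\ldots,(x_k[1],a_k)\big)=\sum_{i=0}^\infty\frac{1}{i!}\,l_{k+i}\big(\underbrace{(\pi[1],R),\ldots,(\pi[1],R)}_{i},(x_1[1],a_1),\ldots,(x_k[1],a_k)\big).$$ (ii) For any $\theta'=(\pi'[1],R')\in(L'[1]\oplus\mathfrak{a})_0$, the sum $\theta+\theta'=((\pi+\pi')[1],R+R')$ defines an rRB Leibniz algebra if and only if $\theta'=(\pi'[1],R')$ is a Maurer-Cartan element in the $L_\infty$-algebra $(L'[1]\oplus\mathfrak{a},\{l_k^{(\pi[1],R)}\}_{k\ge1})$.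
   Context: $\mathbf{k}$ is a field of characteristic $0$; vector spaces, linear maps and tensor products are over $\mathbf{k}$. Leibniz algebra: a vector space $\mathfrak{g}$ with a linear map $[~,~]_\mathfrak{g} = \mu_\mathfrak{g} : \mathfrak{g}\otimes\mathfrak{g}\to\mathfrak{g}$ satisfying $[x,[y,z]_\mathfrak{g}]_\mathfrak{g} = [[x,y]_\mathfrak{g},z]_\mathfrak{g} + [y,[x,z]_\mathfrak{g}]_\mathfrak{g}$. A representation of $\mathfrak{g}$ is a vector space $V$ with linear maps $l_V : \mathfrak{g}\otimes V\to V$, $r_V : V\otimes\mathfrak{g}\to V$ such that for all $x,y\in\mathfrak{g}$, $v\in V$: $l_V(x,l_V(y,v)) = l_V([x,y]_\mathfrak{g},v)+l_V(y,l_V(x,v))$; $l_V(x,r_V(v,y)) = r_V(l_V(x,v),y)+r_V(v,[x,y]_\mathfrak{g})$; $r_V(v,[x,y]_\mathfrak{g}) = r_V(r_V(v,x),y)+l_V(x,r_V(v,y))$. A relative Rota-Baxter operator is a linear map $R:V\to\mathfrak{g}$ with $[R(v),R(v')]_\mathfrak{g} = R(l_V(R(v),v')+r_V(v,R(v')))$ for all $v,v'\in V$. An rRB Leibniz algebra $V\xrightarrow{R}\mathfrak{g}$ consists of a Leibniz algebra $\mathfrak{g}$, a representation $V$ of it and a relative Rota-Baxter operator $R:V\to\mathfrak{g}$. Balavoine bracket: for a vector space $E$, let $C^n(E,E)=\mathrm{Hom}(E^{\otimes n},E)$, and let $C^{\bullet+1}(E,E)=\oplus_{n\ge 0}C^{n+1}(E,E)$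 with $C^{n+1}(E,E)$ in degree $n$. It is a graded Lie algebra with the degree $0$ bracket $[f,g]_\mathsf{B} = f\diamond g-(-1)^{mn}g\diamond f$ for $f\in C^{m+1}(E,E)$, $g\in C^{n+1}(E,E)$, where $$(f\diamond g)(x_1,\ldots,x_{m+n+1}) = \sum_{i=1}^{m+1}(-1)^{(i-1)n}\sum_{\sigma\in Sh(i-1,n)}(-1)^\sigma f(x_{\sigma(1)},\ldots,x_{\sigma(i-1)},g(x_{\sigma(i)},\ldots,x_{\sigma(i+n-1)},x_{i+n}),x_{i+n+1},\ldots,x_{m+n+1}),$$ $(-1)^\sigma$ is the sign of $\sigma$, and $Sh(i,j)$ is the set of $\sigma\in S_{i+j}$ with $\sigma(1)<\cdots<\sigma(i)$ and $\sigma(i+1)<\cdots<\sigma(i+j)$. Bidegree: let $\mathfrak{g}^{k,l}\subset(\mathfrak{g}\oplus V)^{\otimes k+l}$ be the direct sum of all tensor products of $k$ copies of $\mathfrak{g}$ and $l$ copies of $V$ in all orders (zero if $k<0$ or $l<0$). For $k,l\ge -1$ with $k+l=n\geq 0$, $C^{k|l}(\mathfrak{g}\oplus V,\mathfrak{g}\oplus V)$ is the space of $f\in\mathrm{Hom}((\mathfrak{g}\oplus V)^{\otimes n+1},\mathfrak{g}\oplus V)$ with $f(\mathfrak{g}^{k+1,l})\subset\mathfrak{g}$, $f(\mathfrak{g}^{k,l+1})\subset V$ and $f=0$ on the other summands. Maps defined on a tensor product of copies of $\mathfrak{g}$ and $V$ with values in $\mathfrak{g}$ or $V$ are identified with maps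 on $(\mathfrak{g}\oplus V)^{\otimes n}$ by extension by zero (horizontal lift). Let $L=(C^{\bullet+1}(\mathfrak{g}\oplus V,\mathfrak{g}\oplus V),[~,~]_\mathsf{B})$, $L'=\oplus_{k\ge0}C^{k|0}(\mathfrak{g}\oplus V,\mathfrak{g}\oplus V)$ ($C^{k|0}$ in degree $k$; a graded Lie subalgebra), $\mathfrak{a}=\oplus_{l\ge 0}C^{-1|l+1}(\mathfrak{g}\oplus V,\mathfrak{g}\oplus V)\cong\oplus_{l\ge0}\mathrm{Hom}(V^{\otimes l+1},\mathfrak{g})$ ($C^{-1|l+1}$ in degree $l$; an abelian subalgebra), and let $P:L\to L$ be the projection onto $\mathfrak{a}$ that vanishes on all $C^{k|l}$ with $k\ge 0$. The graded space $L'[1]\oplus\mathfrak{a}$ has $(L'[1]\oplus\mathfrak{a})_i=L'_{i+1}\oplus\mathfrak{a}_i$; write $x[1]$ for $x\in L'$ viewed in $L'[1]$. In particular $(L'[1]\oplus\mathfrak{a})_0=\mathrm{Hom}(\mathfrak{g}^{\otimes2},\mathfrak{g})\oplus\mathrm{Hom}(\mathfrak{g}^{1,1},V)\oplus\mathrm{Hom}(V,\mathfrak{g})$, with $\mathfrak{g}^{1,1}=(\mathfrak{g}\otimes V)\oplus(V\otimes\mathfrak{g})$. An element $(\rho[1],T)$ of this space is said to define an rRB Leibniz algebra if, writing $\rho=\mu+l+r$ with $\mu\in\mathrm{Hom}(\mathfrak{g}^{\otimes 2},\mathfrak{g})$, $l\in\mathrm{Hom}(\mathfrak{g}\otimes V,V)$,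 $r\in\mathrm{Hom}(V\otimes\mathfrak{g},V)$, $(\mathfrak{g},\mu)$ is a Leibniz algebra, $(V,l,r)$ is a representation of it and $T:V\to\mathfrak{g}$ is a relative Rota-Baxter operator. $L_\infty$-algebras are in the degree-shifted convention: graded symmetric degree $1$ maps $l_k$ satisfying $\sum_{i+j=n+1}\sum_{\sigma\in Sh(i,n-i)}\epsilon(\sigma)\,l_j(l_i(x_{\sigma(1)},\ldots,x_{\sigma(i)}),x_{\sigma(i+1)},\ldots,x_{\sigma(n)})=0$ for all $n\ge1$ ($\epsilon(\sigma)$ the Koszul sign). The $L_\infty$-structure $\{l_k\}$ on $L'[1]\oplus\mathfrak{a}$ is given by $l_2(q[1],q'[1])=(-1)^{|q|}[q,q']_\mathsf{B}[1]$ and $l_k(q[1],a_1,\ldots,a_{k-1})=P[\cdots[[q,a_1]_\mathsf{B},a_2]_\mathsf{B},\ldots,a_{k-1}]_\mathsf{B}$ for $k\ge2$ (homogeneous $q,q'\in L'$, $a_i\in\mathfrak{a}$), all other components vanishing up to permutation of entries. A Maurer-Cartan element of an $L_\infty$-algebra with structure maps $\{m_k\}$ is a degree $0$ element $\theta$ with $\sum_{k\ge1}\frac1{k!}m_k(\theta,\ldots,\theta)=0$ (the infinite sums occurring here have only finitely many nonzero terms). *)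

(* Defs.v *)
From HB Require Import structures.
From mathcomp Require Import all_boot all_order all_algebra all_fingroup.
From mathcomp Require Import sesquilinear.
From mathcomp Require Import all_classical.

Set Implicit Arguments.
Unset Strict Implicit.
Unset Printing Implicit Defensive.

Import GRing.Theory.

Local Open Scope classical_set_scope.
Local Open Scope ring_scope.

(* Membership in Sh(i, n - i). *)
Definition shuffle (n i : nat) (sg : 'S_n) : bool :=
  [forall a : 'I_n, forall b : 'I_n,
     ((a < b) && ((b < i) || (i <= a)))%N ==> (sg a < sg b)%N].

(* L_infinity-algebras in the degree-shifted convention.
   A graded vector space is a family [X : int -> set W] of subspaces of a common
   ambient space [W].  A homogeneous element is passed to the structure maps
   together with its degree, as [(d, x) : int * W] with [X d x], so that the
   value of [l] on [:: (d1, x1); ..; (dk, xk)] is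
   that of the component X_d1 (x) .. (x) X_dk -> X_(d1 + .. + dk + 1) of l_k.
   The value of [l] on the empty sequence is never used. *)
Section Linfty.
Variables (K : fieldType) (W : lmodType K).

Definition is_subspace (A : set W) : Prop :=
  A 0 /\ forall (c : K) x y, A x -> A y -> A (c *: x + y).

Definition homog (X : int -> set W) (s : seq (int * W)) : Prop :=
  {in s, forall p, X p.1 p.2}.

Definition tdeg (s : seq (int * W)) : int := \sum_(p <- s) p.1.

Definition permt n (t : n.-tuple (int * W)) (sg : 'S_n) : n.-tuple (int * W) :=
  [tuple tnth t (sg i) | i < n].

(* The sign eps with x_1 ... x_n = eps x_sg(1) ... x_sg(n) in the graded
   symmetric algebra. *)
Definition koszul n (t : n.-tuple (int * W)) (sg : 'S_n) : K :=
  \prod_(i < n) \prod_(j < n | (i < j)%N && (sg j < sg i)%N)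
    (-1) ^ ((tnth t (sg i)).1 * (tnth t (sg j)).1).

Definition Linfty_relation (l : seq (int * W) -> W) n
    (t : n.-tuple (int * W)) : Prop :=
  \sum_(1 <= i < n.+1) \sum_(sg : 'S_n | shuffle i sg)
     koszul t sg *:
       (let s := tval (permt t sg) in
        l ((tdeg (take i s) + 1, l (take i s)) :: drop i s)) = 0.

Record is_Linfty (X : int -> set W) (l : seq (int * W) -> W) : Prop := {
  Linfty_subspace : forall d, is_subspace (X d);
  Linfty_degree : forall s, s <> [::] -> homog X s -> X (tdeg s + 1) (l s);
  Linfty_multilinear : forall s1 s2 d (c : K) x y,
    homog X s1 -> homog X s2 -> X d x -> X d y ->
    l (s1 ++ (d, c *: x + y) :: s2) =
      c *: l (s1 ++ (d, x) :: s2) + l (s1 ++ (d, y) :: s2);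
  Linfty_symmetric : forall n (t : n.-tuple (int * W)) (sg : 'S_n),
    (0 < n)%N -> homog X t -> l t = koszul t sg *: l (permt t sg);
  Linfty_jacobi : forall n (t : n.-tuple (int * W)),
    (0 < n)%N -> homog X t -> Linfty_relation l t
}.

Definition fin_summable (A : set nat) (F : nat -> W) : Prop :=
  finite_set [set i | A i /\ F i <> 0].

Definition MC_term (m : seq (int * W) -> W) (th : W) (k : nat) : W :=
  (k`!%:R : K)^-1 *: m (nseq k (0, th)).

(* [\sum_(k \in A)] is the sum of a finitely supported family; it is 0 by
   convention when the support is infinite, hence the finiteness clause. *)
Definition maurer_cartan (X : int -> set W) (m : seq (int * W) -> W)
    (th : W) : Prop :=
  [/\ X 0 th,
      fin_summable [set k | (1 <= k)%N] (MC_term m th) &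
      \sum_(k \in [set k | (1 <= k)%N]) MC_term m th k = 0].

Definition twist_term (l : seq (int * W) -> W) (th : W) (s : seq (int * W))
    (i : nat) : W :=
  (i`!%:R : K)^-1 *: l (nseq i (0, th) ++ s).

Definition twist (l : seq (int * W) -> W) (th : W) (s : seq (int * W)) : W :=
  \sum_(i \in [set: nat]) twist_term l th s i.

End Linfty.

(* Cochains.  An element of \prod_n Hom(E^(x)n, E) is encoded as a function
   [F : seq E -> E] on sequences of all lengths; an element of Hom(E^(x)n, E) is
   such a function which is multilinear and vanishes off the sequences of
   length n. *)
Section Balavoine.
Variables (K : fieldType) (E : lmodType K).

Definition is_cochain (n : int) (F : seq E -> E) : Prop :=
  (forall s, (size s)%:Z <> n -> F s = 0) /\
  (forall s1 s2 (c : K) x y,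
     F (s1 ++ (c *: x + y) :: s2) = c *: F (s1 ++ x :: s2) + F (s1 ++ y :: s2)).

(* f <> g for f, g of degrees m, n (arities m + 1, n + 1), evaluated on
   x_1, .., x_(m+n+1); the summation index [i] is the paper's i minus 1. *)
Definition diamond (m n : nat) (f g : seq E -> E) (x : seq E) : E :=
  \sum_(i < m.+1) (-1 : K) ^+ (i * n) *:
    \sum_(sg : 'S_(i + n) | shuffle i sg) (-1 : K) ^+ (odd_perm sg) *:
      (let y := [seq x`_(sg a) | a : 'I_(i + n)] in
       f (take i y ++ g (rcons (drop i y) x`_(i + n)) :: drop (i + n).+1 x)).

(* The bilinear extension of the graded bracket to all cochains: on sequences
   of length m + n + 1, [diamond m n f g] only involves the component of f of
   degree m and the component of g of degree n. *)
Definition balavoine (f g : seq E -> E) (x : seq E) : E :=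
  \sum_(m < size x)
    let n := ((size x).-1 - m)%N in
    (diamond m n f g x - (-1 : K) ^+ (m * n) *: diamond n m g f x).

Lemma cochain_zero n F s1 s2 : is_cochain n F -> F (s1 ++ 0 :: s2) = 0.
Proof.
case=> _ linF; have := linF s1 s2 1 0 0.
by rewrite scaler0 addr0 scale1r => /esym/(canRL (addrK _)); rewrite subrr.
Qed.

Lemma diamond_wrong_degree (a b : int) (m n : nat) (f g : seq E -> E) x :
    is_cochain a f -> is_cochain b g -> size x = (m + n).+1 ->
    (a <> m.+1%:Z \/ b <> n.+1%:Z) ->
  diamond m n f g x = 0.
Proof.
move=> cf cg sx ab; rewrite /diamond big1// => i _.
rewrite big1 ?scaler0// => sg _; set y := image_mem _ _.
have sy : size y = (i + n)%N by rewrite size_map -cardE card_ord.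
have im : (i <= m)%N by rewrite -ltnS.
case: ab => [am | bn].
  rewrite /= (cf.1 _ _) ?scaler0// => E1; apply: am.
  rewrite -E1 size_cat /= size_takel ?sy ?leq_addr//.
  by rewrite size_drop sx subSS subnDr addnS subnKC.
rewrite /= (cg.1 (rcons _ _)) ?(cochain_zero _ _ cf) ?scaler0// => E1; apply: bn.
by rewrite -E1 size_rcons size_drop sy addKn.
Qed.

Lemma balavoineE (m n : nat) (f g : seq E -> E) (x : seq E) :
    is_cochain m.+1 f -> is_cochain n.+1 g -> size x = (m + n).+1 ->
  balavoine f g x =
    diamond m n f g x - (-1 : K) ^+ (m * n) *: diamond n m g f x.
Proof.
move=> cf cg sx; rewrite /balavoine sx /=.
have mlt : (m < (m + n).+1)%N by rewrite ltnS leq_addr.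
rewrite (bigD1 (Ordinal mlt)) //= addKn big1 ?addr0// => i /eqP ni.
have nim : m.+1%:Z <> i.+1%:Z by case=> E1; apply: ni; apply: val_inj.
have ile : (i <= m + n)%N by rewrite -ltnS.
rewrite (diamond_wrong_degree cf cg) ?sx ?subnKC//; last by left.
rewrite (diamond_wrong_degree cg cf) ?sx ?subnK ?scaler0 ?subr0//.
by right.
Qed.

End Balavoine.

Section RelativeRotaBaxter.
Variables (K : fieldType) (g V : lmodType K).

Definition leibniz_algebra (mu : {bilinear g -> g -> g}) : Prop :=
  forall x y z, mu x (mu y z) = mu (mu x y) z + mu y (mu x z).

Definition leibniz_rep (mu : {bilinear g -> g -> g})
    (lV : {bilinear g -> V -> V}) (rV : {bilinear V -> g -> V}) : Prop :=
  [/\ forall x y v, lV x (lV y v) = lV (mu x y) v + lV y (lV x v),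
      forall x y v, lV x (rV v y) = rV (lV x v) y + rV v (mu x y) &
      forall x y v, rV v (mu x y) = rV (rV v x) y + lV x (rV v y)].

Definition rota_baxter (mu : {bilinear g -> g -> g})
    (lV : {bilinear g -> V -> V}) (rV : {bilinear V -> g -> V})
    (R : {linear V -> g}) : Prop :=
  forall v v', mu (R v) (R v') = R (lV (R v) v' + rV v (R v')).

Definition rRB_leibniz (mu : {bilinear g -> g -> g})
    (lV : {bilinear g -> V -> V}) (rV : {bilinear V -> g -> V})
    (R : {linear V -> g}) : Prop :=
  [/\ leibniz_algebra mu, leibniz_rep mu lV rV & rota_baxter mu lV rV R].

Local Notation E := (g * V)%type.

Definition summand (u : g + V) : E :=
  match u with inl x => (x, 0) | inr v => (0, v) end.

Definition num_g (s : seq (g + V)) : nat :=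
  count (fun u => if u is inl _ then true else false) s.

(* C^{k|l}.  On a pure tensor of arity k + l + 1 from the summands g and V, the
   numbers of entries from g and V are (k + 1, l) iff the first one is k + 1,
   and (k, l + 1) iff the first one is k.  The space is zero unless k, l >= -1
   and k + l >= 0; for arity 0 this is the role of the first clause. *)
Definition bideg (k l : int) (F : seq E -> E) : Prop :=
  [/\ F [::] = 0,
      is_cochain (k + l + 1) F &
      forall s : seq (g + V),
        [/\ (num_g s)%:Z = k + 1 -> (F (map summand s)).2 = 0,
            (num_g s)%:Z = k -> (F (map summand s)).1 = 0 &
            (num_g s)%:Z <> k + 1 -> (num_g s)%:Z <> k ->
              F (map summand s) = 0]].

Definition Lprime (k : int) : set (seq E -> E) := bideg k 0.

Definition afrak (l : int) : set (seq E -> E) := bideg (-1) (l + 1).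

(* The projection onto the C^{-1|l}: restrict to tensor powers of V and take
   the g-component of the value (see [projP_afrak] and [projP_ker]). *)
Definition projP (F : seq E -> E) : seq E -> E :=
  fun s => ((F [seq (0, x.2) | x <- s]).1, 0).

Lemma projP_ker (k l : int) (F : seq E -> E) :
  (0 <= k)%R -> bideg k l F -> projP F = 0.
Proof.
move=> k0 [_ _ bF]; apply/funext => s; rewrite /projP.
set t := [seq inr x.2 | x <- s] : seq (g + V).
have -> : [seq (0, x.2) | x <- s] = map summand t.
  by rewrite /t -map_comp.
have n0 : num_g t = 0%N by rewrite /num_g /t count_map; elim: (s).
have [_ b2 b3] := bF t; case: (eqVneq k 0) => [k00|kn0].
  by rewrite b2 ?n0// k00.
rewrite b3 // n0 => E1; last by move: kn0; rewrite -E1 eqxx.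
have k1 : k = -1 by rewrite -[k](addrK 1) -E1.
by move: k0; rewrite k1.
Qed.

Lemma projP_afrak (l : int) (F : seq E -> E) : afrak l F -> projP F = F.
Proof.
move=> [_ cF bF]; apply/funext => s; rewrite /projP.
have linD s1 s2 x y : F (s1 ++ (x + y) :: s2) = F (s1 ++ x :: s2) + F (s1 ++ y :: s2).
  by have := cF.2 s1 s2 1 x y; rewrite !scale1r.
have mixed : forall s' (t : seq (g + V)), (0 < num_g t)%N ->
    F (map summand t ++ s') = 0.
  elim=> [|x s' IH] t t0.
    have [_ _ b3] := bF t; rewrite cats0 b3 // addNr => -[] E1; by rewrite E1 in t0.
  have -> : x = (x.1, 0) + (0, x.2) :> E by rewrite [RHS]surjective_pairing /= addr0 add0r; case: (x).
  rewrite linD -!(cat_rcons).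
  have r u : rcons (map summand t) (summand u) = map summand (rcons t u) by rewrite map_rcons.
  rewrite (r (inl x.1)) (r (inr x.2)) !IH ?addr0// /num_g -cats1 count_cat addn_gt0.
    by rewrite -/(num_g t) t0.
  by rewrite -/(num_g t) t0.
have pure : forall s' (t : seq (g + V)), num_g t = 0%N ->
    F (map summand t ++ s') = F (map summand t ++ [seq (0, x.2) | x <- s']).
  elim=> [|x s' IH] t t0 //=.
  have {1}-> : x = (x.1, 0) + (0, x.2) :> E by rewrite [RHS]surjective_pairing /= addr0 add0r; case: (x).
  rewrite linD -!(cat_rcons).
  have r u : rcons (map summand t) (summand u) = map summand (rcons t u) by rewrite map_rcons.
  rewrite (r (inl x.1)) (r (inr x.2)) (mixed s' (rcons t (inl x.1))) ?add0r; last first.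
    by rewrite /num_g -cats1 count_cat addn_gt0 orbC.
  by rewrite IH// /num_g -cats1 count_cat -/(num_g t) t0.
have := pure s [::] erefl; rewrite /= => ->.
set t := [seq inr x.2 | x <- s] : seq (g + V).
have -> : [seq (0, x.2) | x <- s] = map summand t by rewrite /t -map_comp.
have n0 : num_g t = 0%N by rewrite /num_g /t count_map; elim: (s).
have [b1 _ _] := bF t; rewrite n0 in b1.
by rewrite -(b1 erefl); case: (F _).
Qed.

(* L'[1] (+) a: the pair (x, a) stands for (x[1], a). *)
Local Notation W := ((seq E -> E) * (seq E -> E))%type.

Definition Lshift (i : int) : set W :=
  [set p | Lprime (i + 1) p.1 /\ afrak i p.2].

(* l_2(q[1], q'[1]) has a sign (-1)^|q| with |q| = d + 1 for q[1] of degree d. *)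
Definition brLprime (s : seq (int * W)) : seq E -> E :=
  match s with
  | [:: (d1, (q1, _)); (_, (q2, _))] =>
      (-1 : K) ^ (d1 + 1) *: balavoine q1 q2
  | _ => 0
  end.

(* The component of l_k, k >= 2, whose j-th entry is in L'[1] and whose other
   entries are in a: that entry is first moved to the front, which produces the
   Koszul sign. *)
Definition derived (s : seq (int * W)) (j : nat) : seq E -> E :=
  let x := nth (0, (0, 0)) s j in
  (-1 : K) ^ (x.1 * tdeg (take j s)) *:
    projP (foldl (@balavoine K E) x.2.1
                 [seq p.2.2 | p <- take j s ++ drop j.+1 s]).

Definition brackets (s : seq (int * W)) : W :=
  (brLprime s,
   if (2 <= size s)%N then \sum_(j < size s) derived s j else 0).

(* Horizontal lifts of mu + lV + rV and of R. *)
Definition lift_structure (mu : {bilinear g -> g -> g})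
    (lV : {bilinear g -> V -> V}) (rV : {bilinear V -> g -> V}) : seq E -> E :=
  fun s => match s with
           | [:: x; y] => (mu x.1 y.1, lV x.1 y.2 + rV x.2 y.1)
           | _ => 0
           end.

Definition lift_operator (R : {linear V -> g}) : seq E -> E :=
  fun s => match s with
           | [:: x] => (R x.2, 0)
           | _ => 0
           end.

Definition rRB_element (mu : {bilinear g -> g -> g})
    (lV : {bilinear g -> V -> V}) (rV : {bilinear V -> g -> V})
    (R : {linear V -> g}) : W :=
  (lift_structure mu lV rV, lift_operator R).

Definition defines_rRB (th : W) : Prop :=
  exists (mu : {bilinear g -> g -> g}) (lV : {bilinear g -> V -> V})
         (rV : {bilinear V -> g -> V}) (R : {linear V -> g}),
    th = rRB_element mu lV rV R /\ rRB_leibniz mu lV rV R.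

Lemma rRB_element_degree0 mu lV rV R : Lshift 0 (@rRB_element mu lV rV R).
Proof.
split; split=> //=.
- split; first by case=> [|x [|y []]].
  case=> [|x1 [|x2 [|x3 s1]]] [|y1 [|y2 s2]] c x y //=;
    rewrite ?scaler0 ?addr0 //.
  + by rewrite !linearPl; congr pair; rewrite /= scalerDr addrACA.
  + by rewrite !linearPr; congr pair; rewrite /= scalerDr addrACA.
- case=> [|[x|x] [|[y|y] [|z s]]] //=; split=> //=;
  by rewrite /num_g /= ?linear0l ?linear0r ?addr0 ?add0r.
- split; first by case=> [|x []].
  case=> [|x1 [|x2 s1]] [|y1 s2] c x y //=; rewrite ?scaler0 ?addr0 //.
  by rewrite linearP /=; apply/eqP; rewrite xpair_eqE eqxx /= scaler0 addr0.
- by case=> [|[x|x] [|y s]] //=; split=> //=; rewrite /num_g /= ?linear0.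
Qed.

End RelativeRotaBaxter.

(* Main.v *)
(* Lists of homogeneous elements carry a signed unshuffle coproduct; sums over
   shuffles in S_n are rewritten as iterated sums over it, so the
   identities between them follow by induction on lists.

   The operation f <> g is f composed with the coderivation generated by g.
   Inserting h after g either puts h inside g or inserts both independently, and
   the second contribution is graded symmetric in g and h. So <> is pre-Lie and
   its commutator satisfies the graded Jacobi identity.

   The L-infinity relation for the derived brackets is Voronov's argument: for
   p, q in L' expand P[..[[p, q], a_1], .., a_n] by the Leibniz rule and apply
   P[x, y] = P[Px, y] + P[x, Py].

   Twisting: since theta has degree 0, the coproduct of theta^n followed by s
   is a binomial sum, hence the twisted relation on s is the sum over n of
   1/n! times the relation on theta^n, s, the terms with nothing but theta in
   the inner bracket adding up to the Maurer-Cartan sum of theta. Similarly the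
   Maurer-Cartan sum of theta' for the twisted brackets is that of
   theta + theta' for the original ones, and the latter is
   (- [rho, rho] / 2, P[[rho, T], T] / 2) at (rho, T). *)
Require Import Defs.
From HB Require Import structures.
From mathcomp Require Import all_boot all_order all_algebra all_fingroup.
From mathcomp Require Import sesquilinear.
From mathcomp Require Import all_classical zify.

Set Implicit Arguments.
Unset Strict Implicit.
Unset Printing Implicit Defensive.

Import Order.TTheory GRing.Theory Num.Theory.

Local Open Scope ring_scope.

(** * Signed unshuffles *)

(** A cochain is a function on lists of every length, so identities are proved where the arity does
    not matter: [ush] and [ins] sum over all splittings at once, and terms of the wrong length
    vanish by themselves. What remains of a degree is its parity; signs are brought to powers of -1
    with boolean exponents, and sign identities become finite case checks.

    The infinite sums are finite for one reason: bracketing with an element of a lowers the first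
    bidegree by 1, and C^{k|l} is zero for k < -1. This gives the explicit bounds at which the sums
    over nat are truncated.

    Characteristic 0 serves to divide by factorials, and by 2 in two places: where ordered pairs
    count each pair of entries twice, and where the Maurer-Cartan equation yields each axiom
    doubled. *)

Section Unshuffle.
Variables (K : fieldType) (T : eqType) (par : T -> bool) (M : lmodType K).
Implicit Types (s a b r : seq T) (x y p q : T).

Definition pars s : bool := foldr (fun x c => par x (+) c) false s.

Lemma pars_cat s1 s2 : pars (s1 ++ s2) = pars s1 (+) pars s2.
Proof. by elim: s1 => //= x s1 ->; rewrite addbA. Qed.

Lemma pars_perm s1 s2 : perm_eq s1 s2 -> pars s1 = pars s2.
Proof.
move=> e; apply: (catCA_perm_subst _ e) => u v w.
by rewrite !pars_cat addbCA.
Qed.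

(* [ush s Phi] is the sum of [Phi a b] over the unshuffles (a, b) of [s], with
   Koszul signs; [extract s Phi] is its part where [a] has a single entry. *)
Fixpoint ush s (Phi : seq T -> seq T -> M) : M :=
  if s is x :: s' then
    ush s' (fun a b => Phi (x :: a) b)
      + ush s' (fun a b => (-1) ^+ (par x && pars a) *: Phi a (x :: b))
  else Phi [::] [::].

Fixpoint extract s (Phi : T -> seq T -> M) : M :=
  if s is x :: s' then
    Phi x s' + extract s' (fun y r => (-1) ^+ (par x && par y) *: Phi y (x :: r))
  else 0.

Lemma eq_ush s Phi Psi :
  (forall a b, perm_eq (a ++ b) s -> Phi a b = Psi a b) ->
  ush s Phi = ush s Psi.
Proof.
elim: s Phi Psi => [|x s IH] Phi Psi e /=; first exact: e.
congr (_ + _); apply: IH => a b ab; first by rewrite e //= perm_cons.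
by rewrite e // -cat1s perm_catCA /= perm_cons.
Qed.

Lemma eq_extract s Phi Psi :
  (forall y r, perm_eq (y :: r) s -> Phi y r = Psi y r) ->
  extract s Phi = extract s Psi.
Proof.
elim: s Phi Psi => [|x s IH] Phi Psi e //=.
congr (_ + _); first exact: e.
apply: IH => y r yr; rewrite e // -(cat1s y) -(cat1s x r) perm_catCA /=.
by rewrite perm_cons.
Qed.

Lemma ushD s Phi Psi :
  ush s (fun a b => Phi a b + Psi a b) = ush s Phi + ush s Psi.
Proof.
elim: s Phi Psi => [|x s IH] Phi Psi //=; rewrite addrACA -2![in RHS]IH.
by congr (_ + _); apply: eq_ush => a b _; rewrite scalerDr.
Qed.

Lemma ushZ s c Phi : ush s (fun a b => c *: Phi a b) = c *: ush s Phi.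
Proof.
elim: s Phi => [|x s IH] Phi //=; rewrite scalerDr -2![in RHS]IH.
by congr (_ + _); apply: eq_ush => a b _; rewrite scalerA mulrC -scalerA.
Qed.

Lemma ush0 s : ush s (fun _ _ => 0) = 0.
Proof.
transitivity (ush s (fun _ _ => 0 *: (0 : M))); last by rewrite ushZ scale0r.
by apply: eq_ush => *; rewrite scale0r.
Qed.

Lemma ush_sum I (r : seq I) (P : pred I) s (Phi : I -> seq T -> seq T -> M) :
  ush s (fun a b => \sum_(i <- r | P i) Phi i a b) =
  \sum_(i <- r | P i) ush s (Phi i).
Proof.
elim: r => [|i r IH].
  by rewrite big_nil -[RHS](ush0 s); apply: eq_ush => a b _; rewrite big_nil.
rewrite big_cons; case: ifP => Pi; rewrite -IH -?ushD.
  by apply: eq_ush => *; rewrite big_cons Pi.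
by apply: eq_ush => *; rewrite big_cons Pi.
Qed.

Lemma extractD s Phi Psi :
  extract s (fun y r => Phi y r + Psi y r) = extract s Phi + extract s Psi.
Proof.
elim: s Phi Psi => [|x s IH] Phi Psi /=; first by rewrite addr0.
rewrite addrACA -IH; congr (_ + _).
by apply: eq_extract => y r _; rewrite scalerDr.
Qed.

Lemma extractZ s c Phi : extract s (fun y r => c *: Phi y r) = c *: extract s Phi.
Proof.
elim: s Phi => [|x s IH] Phi /=; first by rewrite scaler0.
rewrite scalerDr -IH.
by congr (_ + _); apply: eq_extract => y r _; rewrite scalerA mulrC -scalerA.
Qed.

Lemma extract0 s : extract s (fun _ _ => 0) = 0.
Proof.
transitivity (extract s (fun _ _ => 0 *: (0 : M))); last by rewrite extractZ scale0r.
by apply: eq_extract => *; rewrite scale0r.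
Qed.

(** The coproduct is graded cocommutative: exchanging the parts costs the sign of moving one past
    the other. In the induction the two summands for the head of the list trade places. *)
Lemma ush_cocomm s Phi :
  ush s Phi = ush s (fun a b => (-1) ^+ (pars a && pars b) *: Phi b a).
Proof.
elim: s Phi => [|x s IH] Phi /=; first by rewrite scale1r.
rewrite addrC (IH (fun a b => _ *: _)) (IH (fun a b => Phi (x :: a) b)).
congr (_ + _); apply: eq_ush => a b _; rewrite !scalerA -!signr_addb;
  congr (_ ^+ nat_of_bool _ *: _); by case: (par x) (pars a) (pars b) => [] [] [].
Qed.

(** Coassociativity with one of three parts a single entry. This and [ush_extractr] bring a
    distinguished entry of either part to the front of the whole list; from the second part it
    crosses the entries of [a], whence the extra sign there. *)
Lemma ush_extractl s (F : T -> seq T -> seq T -> M) :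
  ush s (fun a b => extract a (fun p a' => F p a' b)) =
  extract s (fun p r => ush r (F p)).
Proof.
elim: s F => [|x s IH] F //=; rewrite ushD -addrA; congr (_ + _).
under [X in _ = X]eq_extract => p r _ do rewrite scalerDr -2!ushZ.
rewrite extractD -2!IH; congr (_ + _).
apply: eq_ush => a b _; rewrite -extractZ; apply: eq_extract => p r pr.
rewrite scalerA -signr_addb; congr (_ ^+ nat_of_bool _ *: _).
by rewrite -(pars_perm pr) /=; case: (par x) (par p) (pars r) => [] [] [].
Qed.

Lemma ush_extractr s (F : T -> seq T -> seq T -> M) :
  ush s (fun a b => extract b (fun q b' => F q a b')) =
  extract s (fun q r => ush r (fun a b => (-1) ^+ (par q && pars a) *: F q a b)).
Proof.
elim: s F => [|x s IH] F //=.
under [X in _ + X]eq_ush => a b _ do rewrite scalerDr.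
rewrite ushD addrCA; congr (_ + _).
under [X in _ = X]eq_extract => p r _ do rewrite scalerDr -!ushZ.
rewrite extractD IH; congr (_ + _).
  apply: eq_extract => p r _; apply: eq_ush => a b _; rewrite scalerA -signr_addb.
  by congr (_ ^+ nat_of_bool _ *: _); case: (par x) (par p) (pars a) => [] [] [].
under eq_ush => a b _ do rewrite -extractZ.
rewrite IH; apply: eq_extract => p r _; apply: eq_ush => a b _.
rewrite !scalerA -!signr_addb; congr (_ ^+ nat_of_bool _ *: _).
by case: (par x) (par p) (pars a) => [] [] [].
Qed.

Lemma extract_extract_sym s (F : T -> T -> seq T -> M) :
  extract s (fun p r => extract r (F p)) =
  extract s (fun p r => extract r (fun q r' => (-1) ^+ (par p && par q) *: F q p r')).
Proof.
elim: s F => [|x s IH] F //=.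
under [X in _ + X = _]eq_extract => p r _ do rewrite scalerDr -extractZ.
under [X in _ = _ + X]eq_extract => p r _ do rewrite scalerDr -extractZ.
rewrite !extractD !addrA; congr (_ + _).
  rewrite addrC; congr (_ + _); apply: eq_extract => p r _; rewrite scalerA.
  by rewrite -signr_addb; case: (par x) (par p) => [] []; rewrite /= ?scale1r.
rewrite IH; apply: eq_extract => p r _; apply: eq_extract => q r' _.
rewrite !scalerA -!signr_addb; congr (_ ^+ nat_of_bool _ *: _).
by case: (par x) (par p) (par q) => [] [] [].
Qed.

Lemma ush_nil s (F : seq T -> M) :
  ush s (fun a b => if a is [::] then F b else 0) = F s.
Proof.
elim: s F => [|x s IH] F //=; rewrite ush0 add0r -(IH (fun b => F (x :: b))).
by apply: eq_ush => -[|y a] b _ /=; rewrite ?andbF ?scale1r ?scaler0.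
Qed.

Lemma ush_single s (F : T -> seq T -> M) :
  ush s (fun a b => if a is [:: p] then F p b else 0) = extract s F.
Proof.
elim: s F => [|x s IH] F //=; rewrite -IH -(ush_nil s (F x)).
congr (_ + _); apply: eq_ush => -[|y [|z a]] b _ /=; rewrite ?addbF ?scaler0 //.

Qed.

(** Extracting two entries in succession meets every pair in both orders, and by the symmetry of [F]
    both orders contribute equally, whence the factor 2. *)
Lemma ush_pair s (F : T -> T -> seq T -> M) :
  (forall p q r, perm_eq [:: p, q & r] s ->
    F q p r = (-1) ^+ (par p && par q) *: F p q r) ->
  ush s (fun a b => if a is [:: p; q] then F p q b else 0) *+ 2 =
  extract s (fun p r => extract r (F p)).
Proof.
elim: s F => [|x s IH] F symF /=; first by rewrite mul0rn.
rewrite mulrnDl.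
under [X in _ = _ + X]eq_extract => p r pr do rewrite scalerDr -extractZ.
rewrite extractD [RHS]addrA; congr (_ + _).
  rewrite mulr2n -2!ush_single; congr (_ + _).
  apply: eq_ush => -[|y[|z a]] b ab //.
  rewrite (symF x) ?perm_cons // scalerA -signr_addb.
  by case: (par x && par y); rewrite scale1r.
transitivity (ush s (fun a b => if a is [:: p; q] then
    (-1) ^+ (par x && (par p (+) par q)) *: F p q (x :: b) else 0) *+ 2).
  by congr (_ *+ 2); apply: eq_ush => -[|y[|z [|? a]]] b _ /=;
    rewrite ?addbF ?scaler0.
rewrite IH => [|p q r pqr].
  apply: eq_extract => p r _; apply: eq_extract => q r' _; rewrite scalerA -signr_addb.
  by congr (_ ^+ nat_of_bool _ *: _); case: (par x) (par p) (par q) => [] [] [].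
rewrite (symF p q) ?scalerA 1?addbC; last first.
  by rewrite -[[:: p, q & _]](cat_cons p [:: q]) -(cat1s x) perm_catCA /= perm_cons.
by rewrite mulrC.
Qed.

End Unshuffle.

(** * Sums over shuffles *)

Section Inversions.
Variables (K : comPzRingType) (n : nat) (e : 'I_n -> 'I_n -> K).
Implicit Types (w s : seq 'I_n) (A : {set 'I_n}) (x y : 'I_n).

(** A sign is kept as a product of weights [e x y] over inverted pairs; Koszul signs are the case
    [e = pairsign]. The pairs between two blocks are all that remains when both blocks are
    increasing. *)
Definition crossing s1 s2 : K :=
  \prod_(x <- s1) \prod_(y <- s2 | (y < x)%N) e x y.

Fixpoint inversions w : K :=
  if w is x :: w' then (\prod_(y <- w' | (y < x)%N) e x y) * inversions w'
  else 1.

Lemma inversionsE m (h : 'I_m -> 'I_n) :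
  \prod_(i < m) \prod_(j < m | (i < j)%N && (h j < h i)%N) e (h i) (h j) =
  inversions (map h (enum 'I_m)).
Proof.
elim: m h => [|m IH] h.
  rewrite big_ord0 (_ : enum 'I_0 = [::]) //.
  by apply: size0nil; rewrite size_enum_ord.
rewrite enum_ordSl big_ord_recl /= -map_comp -IH; congr (_ * _).
  rewrite big_mkcond big_ord_recl /= mul1r -big_mkcond big_map /=.
  by rewrite big_enum_cond.
apply: eq_bigr => i _; rewrite big_mkcond big_ord_recl /= mul1r -big_mkcond /=.
by apply: eq_bigl => j; rewrite ltn_add2l.
Qed.

Let ord_ltn := relpre val ltn : rel 'I_n.

Let ord_ltn_trans : transitive ord_ltn.
Proof. by move=> x y z; apply: ltn_trans. Qed.

Let ord_ltn_irr : irreflexive ord_ltn.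
Proof. by move=> x; apply: ltnn. Qed.

Lemma inversions_sorted w : sorted ord_ltn w -> inversions w = 1.
Proof.
elim: w => //= x w IH xw; rewrite IH ?(path_sorted xw) // mulr1.
rewrite big_seq_cond big_pred0 // => y; apply/andP => -[yw yx].
have := allP (order_path_min ord_ltn_trans xw) _ yw.
by rewrite /ord_ltn /= ltnNge (ltnW yx).
Qed.

Lemma inversions_cat s1 s2 : sorted ord_ltn s1 -> sorted ord_ltn s2 ->
  inversions (s1 ++ s2) = crossing s1 s2.
Proof.
move=> + srt2; elim: s1 => [|x s1 IH] /=.
  by rewrite inversions_sorted /crossing ?big_nil.
move=> xs1; rewrite IH ?(path_sorted xs1) // /crossing big_cons; congr (_ * _).
rewrite big_cat /= big_seq_cond big_pred0 ?mul1r // => y.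
apply/andP => -[ys1 yx].
have := allP (order_path_min ord_ltn_trans xs1) _ ys1.
by rewrite /ord_ltn /= ltnNge (ltnW yx).
Qed.

Definition inset A s := [seq x <- s | x \in A].
Definition outset A s := [seq x <- s | x \notin A].

Lemma enum_ord_sorted : sorted ord_ltn (enum 'I_n).
Proof. by rewrite -sorted_map val_enum_ord iota_ltn_sorted. Qed.

Lemma inset_sorted A s : sorted ord_ltn s -> sorted ord_ltn (inset A s).
Proof. exact: sorted_filter. Qed.

Lemma outset_sorted A s : sorted ord_ltn s -> sorted ord_ltn (outset A s).
Proof. exact: sorted_filter. Qed.

Definition unshuffled A := inset A (enum 'I_n) ++ outset A (enum 'I_n).

Lemma unshuffled_perm A : perm_eq (unshuffled A) (enum 'I_n).
Proof. by rewrite /unshuffled /inset /outset perm_filterC. Qed.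

Lemma size_unshuffled A : size (unshuffled A) = n.
Proof. by rewrite (perm_size (unshuffled_perm A)) size_enum_ord. Qed.

Lemma size_inset A : size (inset A (enum 'I_n)) = #|A|.
Proof. by rewrite cardE /inset enumT /enum_mem; congr size. Qed.

Lemma unshuffled_inj A : injective (fun k : 'I_n => nth k (unshuffled A) k).
Proof.
move=> k k'; rewrite (set_nth_default k' k) ?size_unshuffled // => /eqP.
rewrite nth_uniq ?size_unshuffled // => [/eqP/val_inj//|].
by rewrite (perm_uniq (unshuffled_perm A)) enum_uniq.
Qed.

Definition unshuffle A : 'S_n := perm (@unshuffled_inj A).

Lemma map_unshuffle A : map (unshuffle A) (enum 'I_n) = unshuffled A.
Proof.
case: (posnP n) => [n0|n0].
  by rewrite (size0nil (etrans (size_unshuffled A) n0))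
    (size0nil (etrans (size_enum_ord n) n0)).
pose k0 := Ordinal n0.
apply: (@eq_from_nth _ k0).
  by rewrite size_map size_enum_ord size_unshuffled.
move=> k; rewrite size_map size_enum_ord => kn.
rewrite (nth_map k0) ?size_enum_ord // permE nth_enum_ord //.
by apply: set_nth_default; rewrite size_unshuffled.
Qed.

(* A shuffle is determined by the set of its first i values. *)
Lemma big_shuffle (M : zmodType) i (F : seq 'I_n -> M) : (i <= n)%N ->
  \sum_(sg : 'S_n | shuffle i sg) F (map sg (enum 'I_n)) =
  \sum_(A : {set 'I_n} | #|A| == i) F (unshuffled A).
Proof.
move=> le_in; pose first (sg : 'S_n) := (sg @: [set a : 'I_n | (a < i)%N])%SET.
have card_first sg : #|first sg| = i.
  rewrite card_imset; last exact: perm_inj.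
  have := big_ord_widen (op := addn) (idx := 0%N) n (fun _ => 1%N) le_in.
  rewrite big_const_ord iter_addn_0 mul1n => {2}->.
  by rewrite -sum1_card; apply: eq_bigl => a; rewrite inE.
have nth_in A (k : 'I_n) : (k < #|A|)%N -> nth k (unshuffled A) k \in A.
  rewrite -size_inset => kA; rewrite nth_cat kA.
  by have := mem_nth k kA; rewrite mem_filter => /andP[].
rewrite (reindex_onto unshuffle first) /=.
  apply: eq_big => [A|A _]; last by rewrite map_unshuffle.
  apply/andP/eqP => [[_ /eqP <-]//|cA]; split.
    apply/forallP => a; apply/forallP => b; apply/implyP => /andP[ab H].
    rewrite !permE (set_nth_default a b) ?size_unshuffled //.
    rewrite !nth_cat size_inset cA; case: (ltnP a i) H => [ai|ia] /=.
      rewrite orbF => bi; rewrite bi.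
      apply: (sorted_ltn_nth ord_ltn_trans a (inset_sorted A enum_ord_sorted)) => //.
        by rewrite inE size_inset cA.
      by rewrite inE size_inset cA.
    move=> _; rewrite (ltnNge b i) (leq_trans ia (ltnW ab)) /=.
    have so : (size (outset A (enum 'I_n)) = n - i)%N.
      have := size_unshuffled A; rewrite /unshuffled size_cat size_inset cA => E.
      by apply/eqP; rewrite -(eqn_add2l i) E subnKC.
    have sb k : (i <= k < n)%N -> (k - i < n - i)%N.
      by case/andP=> ik kn; rewrite ltn_sub2r // (leq_ltn_trans ik kn).
    apply: (sorted_ltn_nth ord_ltn_trans a (outset_sorted A enum_ord_sorted)).
    - by rewrite inE so sb // ia ltn_ord.
    - by rewrite inE so sb // ltn_ord (leq_trans ia (ltnW ab)).
    - by rewrite ltn_sub2r // (leq_ltn_trans ia ab).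
  rewrite eqEcard card_first cA leqnn andbT; apply/fintype.subsetP => x /imsetP[a].
  by rewrite inE permE => ai ->; rewrite nth_in ?cA.
move=> sg /forallP sh; apply/permP => a.
pose w := map sg (enum 'I_n).
have szw : size w = n by rewrite size_map size_enum_ord.
have nthw k (kn : (k < n)%N) x : nth x w k = sg (Ordinal kn).
  rewrite (nth_map (Ordinal kn)) ?size_enum_ord //; congr (sg _).
  by apply: val_inj; rewrite /= nth_enum_ord.
have nthb (b : 'I_n) x : nth x w b = sg b.
  by rewrite (nthw _ (ltn_ord b)); congr (sg _); apply: val_inj.
have shw x : {in [pred k | (k < n)%N] &, forall k k', (k < k')%N ->
    (k' < i)%N || (i <= k)%N -> ord_ltn (nth x w k) (nth x w k')}.
  move=> k k' kn kn' kk' H; rewrite !nthw.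
  by have /forallP/(_ (Ordinal kn'))/implyP := sh (Ordinal kn); apply; rewrite /= kk'.
have uw : uniq w by rewrite map_inj_uniq ?enum_uniq //; exact: perm_inj.
have memw x : x \in w.
  by apply/mapP; exists ((sg^-1)%g x); rewrite ?mem_enum ?permKV.
have mem_take x : x \in take i w = (x \in first sg).
  apply/idP/imsetP => [|[b + ->]].
    move=> /(nthP x)[k]; rewrite size_takel ?szw // => ki.
    rewrite nth_take // (nthw _ (leq_trans ki le_in)) => <-.
    by exists (Ordinal (leq_trans ki le_in)); rewrite ?inE.
  rewrite inE => bi; rewrite -(nthb b x) -(nth_take _ bi).
  by rewrite mem_nth ?size_takel ?szw.
have -> : unshuffle (first sg) a = nth a (unshuffled (first sg)) a by rewrite permE.
(* Both halves of [w] are increasing because [sg] is a shuffle, and an increasing list is determined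
   by its elements. *)
suff -> : unshuffled (first sg) = w by [].
rewrite -(cat_take_drop i w) /unshuffled; congr (_ ++ _).
  apply: (irr_sorted_eq ord_ltn_trans ord_ltn_irr).
  - exact/inset_sorted/enum_ord_sorted.
  - rewrite (sorted_pairwise ord_ltn_trans); apply/(pairwiseP a) => k k'.
    rewrite !inE size_takel ?szw // => ki ki' kk'; rewrite !nth_take //.
    by apply: shw; rewrite ?inE ?ki' // ?(leq_trans ki) ?(leq_trans ki').
  - by move=> x; rewrite mem_take mem_filter mem_enum andbT.
apply: (irr_sorted_eq ord_ltn_trans ord_ltn_irr).
- exact/outset_sorted/enum_ord_sorted.
- rewrite (sorted_pairwise ord_ltn_trans); apply/(pairwiseP a) => k k'.
  rewrite !inE size_drop szw !ltn_subRL => ki ki' kk'; rewrite !nth_drop.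
  by apply: shw; rewrite ?inE ?leq_addr ?orbT // ltn_add2l.
- move=> x; rewrite mem_filter mem_enum andbT -mem_take.
  have := memw x; have := uw; rewrite -(cat_take_drop i w) mem_cat cat_uniq.
  case/and3P=> _ /hasPn/(_ x) H _ /orP[xt|xd].
    by rewrite cat_take_drop xt /=; apply/esym/negbTE/negP => /H; rewrite xt.
  by rewrite cat_take_drop xd H.
Qed.

End Inversions.

(** * From sums over permutations to recursive unshuffles *)

Section ShuffleSums.
Variables (K : fieldType) (T : eqType) (par : T -> bool) (M : lmodType K).
Implicit Types (Phi : seq T -> seq T -> M).

Definition pairsign n (h : 'I_n -> T) x y : K := (-1) ^+ (par (h x) && par (h y)).

Lemma prod_pairsign n (h : 'I_n -> T) x s :
  \prod_(y <- s) pairsign h y x = (-1) ^+ (par (h x) && pars par (map h s)).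
Proof.
elim: s => [|y s IH] /=; first by rewrite big_nil andbF.
rewrite big_cons IH -signr_addb; congr (_ ^+ nat_of_bool _).
by case: (par (h x)) (par (h y)) => [] [].
Qed.

(** An unshuffle records which positions go to the first part. As [s] is increasing, a head outside
    [A] is smaller than all that follows and is inverted with exactly the members of [A]; this is
    the sign in the second summand of [ush]. *)
Lemma ush_subsets n (h : 'I_n -> T) (s : seq 'I_n) Phi :
  sorted (relpre val ltn) s ->
  ush par (map h s) Phi =
  \sum_(A : {set 'I_n} | A \subset s)
    crossing (pairsign h) (inset A s) (outset A s) *:
      Phi (map h (inset A s)) (map h (outset A s)).
Proof.
elim: s Phi => [|x s IH] Phi /=.
  move=> _; rewrite (big_pred1 finset.set0) => [|A]; last first.
    by apply/fintype.subsetP/eqP => [A0|-> y]; [apply/finset.setP => y; rewrite inE;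
      apply/negP => /A0 | rewrite inE].
  by rewrite /crossing big_nil scale1r.
move=> xs; have ltx_trans : transitive (relpre (@nat_of_ord n) ltn).
  by move=> ? ? ?; apply: ltn_trans.
have ltxs := allP (order_path_min ltx_trans xs).
have xNs : x \notin s by apply/negP => /ltxs; rewrite /= ltnn.
rewrite !IH ?(path_sorted xs) // [RHS](bigID (fun A : {set _} => x \in A)) /=.
rewrite [LHS]addrC [RHS]addrC; congr (_ + _).
  apply: eq_big => [A|A As].
    apply/fintype.subsetP/andP => [As|[/fintype.subsetP As xA] y yA].
      split; last by apply: contraNN xNs => /As.
      by apply/fintype.subsetP => y /As ys; rewrite inE ys orbT.
    by have := As y yA; rewrite inE => /orP[/eqP yx|//]; rewrite -yx yA in xA.
  have xA : x \notin A by apply: contraNN xNs; apply: (fintype.subsetP As).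
  rewrite /inset /outset /= xA (negbTE xA) /= scalerA; congr (_ *: _).
  rewrite mulrC -prod_pairsign -big_split /= /crossing.
  apply: eq_big_seq => y; rewrite mem_filter => /andP[_ /ltxs /= xy].
  by rewrite big_cons xy.
rewrite [RHS](reindex_onto (fun B => x |: B)%SET (fun A => A :\ x)%SET) /=; last first.
  by move=> A /andP[_ xA]; rewrite finset.setD1K.
apply: eq_big => [A|A As].
  rewrite finset.setU11 andbT.
  apply/fintype.subsetP/andP => [As|[/fintype.subsetP As /eqP A'] y yA].
    split.
      apply/fintype.subsetP => y; rewrite !inE => /orP[/eqP->|/As->]; first by rewrite eqxx.
      by rewrite orbT.
    rewrite finset.setU1K //; by apply: contraNN xNs => /As.
  have := As y; rewrite !inE yA orbT => /(_ isT)/orP[/eqP yx|//].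
  by move: yA; rewrite -A' yx !inE eqxx.
have xA : x \notin A by apply: contraNN xNs; apply: (fintype.subsetP As).
have E : inset (x |: A)%SET s = inset A s /\ outset (x |: A)%SET s = outset A s.
  split; apply: eq_in_filter => y ys; rewrite !inE;
    by case: eqP => // yx; rewrite -yx ys in xNs.
rewrite /inset /outset in E *; rewrite /= finset.setU11 /= !E.1 !E.2.
congr (_ *: _); rewrite /crossing big_cons [X in _ = X * _]big_seq_cond.
rewrite [X in _ = X * _]big_pred0 ?mul1r // => y.
by apply/andP => -[]; rewrite mem_filter => /andP[_ /ltxs /= xy]; rewrite ltnNge (ltnW xy).
Qed.

(** Serves twice: with [par] constantly true for [diamond], and with the parity of degrees for
    [Linfty_relation]. *)
Lemma shuffle_ush n i (t : n.-tuple T) Phi : (i <= n)%N ->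
  \sum_(sg : 'S_n | shuffle i sg)
    (\prod_(a < n) \prod_(b < n | (a < b)%N && (sg b < sg a)%N)
       pairsign (tnth t) (sg a) (sg b)) *:
      (let s := [seq tnth t (sg a) | a : 'I_n] in Phi (take i s) (drop i s)) =
  ush par t (fun a b => if size a == i then Phi a b else 0).
Proof.
move=> le_in; rewrite -[in RHS](map_tnth_enum t) ush_subsets ?enum_ord_sorted //.
pose F w := inversions (pairsign (tnth t)) w *:
  Phi (take i (map (tnth t) w)) (drop i (map (tnth t) w)).
transitivity (\sum_(sg : 'S_n | shuffle i sg) F (map sg (enum 'I_n))).
  apply: eq_bigr => sg _.
  by rewrite (inversionsE (pairsign (tnth t)) sg) /F -(map_comp (tnth t) sg).
rewrite (big_shuffle F) // big_mkcond /= [RHS]big_mkcond /=; apply: eq_bigr => A _.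
rewrite size_map size_inset; case: eqP => [cA|_]; last by rewrite scaler0 if_same.
rewrite ifT; last by apply/fintype.subsetP => y _; rewrite mem_enum.
rewrite /F /unshuffled inversions_cat ?inset_sorted ?outset_sorted ?enum_ord_sorted //.
by rewrite map_cat take_size_cat ?drop_size_cat // size_map size_inset.
Qed.

End ShuffleSums.

Lemma big_signr (R : pzRingType) (I : finType) (P : pred I) (f : I -> nat) :
  \prod_(i | P i) (-1 : R) ^+ f i = (-1) ^+ (\sum_(i | P i) f i).
Proof.
by rewrite (big_morph (fun k => (-1 : R) ^+ k) (exprD _) (expr0 _)).
Qed.

(* The Vandermonde determinant of the nodes sg 0, .., sg (n - 1) is
   (-1)^sg times that of 0, .., n - 1, and the latter is positive. *)
Lemma inversions_odd_perm (R : pzRingType) n (sg : 'S_n) :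
  \prod_(a < n) \prod_(b < n | (a < b)%N && (sg b < sg a)%N) (-1 : R) =
  (-1) ^+ odd_perm sg.
Proof.
pose N := (\sum_(a < n) \sum_(b < n | (a < b)%N && (sg b < sg a)%N) 1)%N.
have prodN (S : pzRingType) :
    \prod_(a < n) \prod_(b < n | (a < b)%N && (sg b < sg a)%N) (-1 : S) =
    (-1) ^+ N.
  rewrite -big_signr; apply: eq_bigr => a _; rewrite -big_signr.
  by apply: eq_bigr => b _; rewrite expr1.
rewrite prodN -signr_odd; congr (_ ^+ nat_of_bool _).
pose v : 'rV[int]_n := \row_j (j : nat)%:Z.
have dV : \det (Vandermonde n (col_perm sg v)) = (-1) ^+ sg * \det (Vandermonde n v).
  have -> : Vandermonde n (col_perm sg v) = col_perm sg (Vandermonde n v).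
    by apply/matrixP => i j; rewrite !mxE.
  by rewrite col_permE det_mulmx det_perm odd_permV mulrC.
have sgprod (f : 'I_n -> 'I_n -> int) :
    Num.sg (\prod_(a < n) \prod_(b < n | (a < b)%N) f a b) =
    \prod_(a < n) \prod_(b < n | (a < b)%N) Num.sg (f a b).
  rewrite (big_morph Num.sg (@sgrM _) (@sgr1 _)); apply: eq_bigr => a _.
  by rewrite (big_morph Num.sg (@sgrM _) (@sgr1 _)).
have := congr1 Num.sg dV; rewrite !det_Vandermonde sgrM !sgprod.
rewrite [X in _ = _ * X]big1 ?mulr1 => [|a _]; last first.
  by rewrite big1 // => b ab; rewrite !mxE gtr0_sg // subr_gt0 ltz_nat.
rewrite sgrX sgrN1.
have -> : \prod_(a < n) \prod_(b < n | (a < b)%N)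
    Num.sg (col_perm sg v 0 b - col_perm sg v 0 a) = (-1) ^+ N :> int.
  rewrite -prodN; apply: eq_bigr => a _; rewrite [RHS]big_mkcondr.
  apply: eq_bigr => b ab; rewrite !mxE.
  case: (ltngtP (sg b) (sg a)) => [ba|ba|/val_inj/perm_inj ba].
  - by rewrite ltr0_sg // subr_lt0 ltz_nat.
  - by rewrite gtr0_sg // subr_gt0 ltz_nat.
  - by rewrite ba ltnn in ab.
by rewrite -signr_odd; case: (odd N) (odd_perm sg) => [] [].
Qed.

(** * The Balavoine bracket *)

(** Closes equalities of sums whose terms cancel in pairs. The trailing 0 added at the start gives
    every summand a tail, so that the patterns also cover the last one. *)
Ltac zmod_cancel :=
  apply/eqP; rewrite -subr_eq0; apply/eqP;
  rewrite -[LHS]addr0 ?(opprD, opprK, oppr0) -?addrA;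
  repeat match goal with
  | |- 0 = 0 => reflexivity
  | |- 0 + _ = 0 => rewrite add0r
  | |- - ?x + (?y + ?r) = 0 => unify x y; rewrite (addKr x r)
  | |- ?x + (- ?y + ?r) = 0 => unify x y; rewrite (addNKr x r)
  | |- - ?x + ?s = 0 => match s with context [?z + (?y + ?r)] =>
      unify x y; rewrite (addrCA z y r) end
  | |- ?x + ?s = 0 => match s with context [?z + (- ?y + ?r)] =>
      unify x y; rewrite (addrCA z (- y) r) end
  end.

(** * Coderivations as a recursion on lists *)

Section Insertion.
Variables (K : fieldType) (E : lmodType K).

Definition multilinear (M : lmodType K) (F : seq E -> M) : Prop :=
  forall s1 s2 (c : K) x y,
    F (s1 ++ (c *: x + y) :: s2) = c *: F (s1 ++ x :: s2) + F (s1 ++ y :: s2).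

Lemma multilinear0 (M : lmodType K) (F : seq E -> M) s1 s2 :
  multilinear F -> F (s1 ++ 0 :: s2) = 0.
Proof.
move=> linF; have := linF s1 s2 (-1) 0 0.
by rewrite scaler0 addr0 scaleN1r addNr.
Qed.

Lemma multilinear_cons (M : lmodType K) (F : seq E -> M) x :
  multilinear F -> multilinear (fun w => F (x :: w)).
Proof. by move=> linF s1 s2; apply: (linF (x :: s1)). Qed.

(* The functional [Phi] applied to the coderivation generated by [G]: every
   entry is read in turn as the last argument of [G], as an earlier argument
   of [G], or as an entry passed over by [G], whose degree has parity [b]. *)
Fixpoint ins (M : lmodType K) (b : bool) (G : seq E -> E) (Phi : seq E -> M)
    (s : seq E) : M :=
  if s is x :: s' then
    Phi (G [:: x] :: s') +
    (ins (~~ b) (fun u => G (x :: u)) Phi s' +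
     (-1) ^+ b *: ins b G (fun w => Phi (x :: w)) s')
  else 0.

Section Linearity.
Variable M : lmodType K.
Implicit Types (G H : seq E -> E) (Phi Psi : seq E -> M).

Lemma ins_linearr b G Phi Psi c s :
  ins b G (fun w => c *: Phi w + Psi w) s = c *: ins b G Phi s + ins b G Psi s.
Proof.
elim: s b G Phi Psi => [|x s IH] b G Phi Psi /=; first by rewrite scaler0 addr0.
rewrite !IH !scalerDr [in RHS]addrACA; congr (_ + _).
rewrite [in RHS]addrACA; congr (_ + _); congr (_ + _).
by rewrite !scalerA mulrC.
Qed.

Lemma ins_linearl b G H Phi c s : multilinear Phi ->
  ins b (fun w => c *: G w + H w) Phi s = c *: ins b G Phi s + ins b H Phi s.
Proof.
elim: s b G H Phi => [|x s IH] b G H Phi linPhi /=; first by rewrite scaler0 addr0.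
rewrite !IH //; last exact: multilinear_cons.
rewrite (linPhi [::]) !scalerDr [in RHS]addrACA; congr (_ + _).
rewrite [in RHS]addrACA; congr (_ + _); congr (_ + _).
by rewrite !scalerA mulrC.
Qed.

Lemma insDr b G Phi Psi s :
  ins b G (fun w => Phi w + Psi w) s = ins b G Phi s + ins b G Psi s.
Proof.
rewrite -[X in _ = X + _]scale1r -ins_linearr.
by congr (ins _ _ _ _); apply/funext => w; rewrite scale1r.
Qed.

Lemma insDl b G H Phi s : multilinear Phi ->
  ins b (fun w => G w + H w) Phi s = ins b G Phi s + ins b H Phi s.
Proof.
move=> linPhi; rewrite -[X in _ = X + _]scale1r -ins_linearl //.
by congr (ins _ _ _ _); apply/funext => w; rewrite scale1r.
Qed.

Lemma ins0r b G s : ins b G (fun _ => 0 : M) s = 0.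
Proof.
transitivity (ins b G (fun _ => -1 *: (0 : M) + 0) s).
  by congr (ins _ _ _ _); apply/funext => w; rewrite scaler0 addr0.
by rewrite ins_linearr scaleN1r addNr.
Qed.

Lemma ins_multilinear b G Phi :
  multilinear G -> multilinear Phi -> multilinear (ins b G Phi).
Proof.
move=> + + s1 s2 c x y.
elim: s1 b G Phi => [|z s1 IH] b G Phi linG linPhi /=.
  rewrite (linG [::] [::]) (linPhi [::]).
  have -> : (fun u => G ((c *: x + y) :: u)) = fun u => c *: G (x :: u) + G (y :: u).
    by apply/funext => u; apply: (linG [::]).
  have -> : (fun w => Phi ((c *: x + y) :: w)) = fun w => c *: Phi (x :: w) + Phi (y :: w).
    by apply/funext => w; apply: (linPhi [::]).
  rewrite ins_linearl // ins_linearr !scalerDr [in RHS]addrACA; congr (_ + _).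
  rewrite [in RHS]addrACA; congr (_ + _); congr (_ + _).
  by rewrite !scalerA mulrC.
rewrite !IH //; try exact: multilinear_cons.
rewrite -cat_cons linPhi !scalerDr [in RHS]addrACA; congr (_ + _).
rewrite [in RHS]addrACA; congr (_ + _); congr (_ + _).
by rewrite !scalerA mulrC.
Qed.

Lemma insZr b G Phi c s : ins b G (fun w => c *: Phi w) s = c *: ins b G Phi s.
Proof.
rewrite -[RHS]addr0 -(ins0r b G s) -ins_linearr.
by congr (ins _ _ _ _); apply/funext => w; rewrite addr0.
Qed.

Lemma ins0l b Phi s : multilinear Phi -> ins b (fun _ => 0) Phi s = 0.
Proof.
move=> linPhi; transitivity (ins b (fun _ => -1 *: (0 : E) + 0) Phi s).
  by congr (ins _ _ _ _); apply/funext => w; rewrite scaler0 addr0.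
by rewrite ins_linearl // scaleN1r addNr.
Qed.

Lemma insZl b G Phi c s : multilinear Phi ->
  ins b (fun w => c *: G w) Phi s = c *: ins b G Phi s.
Proof.
move=> linPhi; rewrite -[RHS]addr0 -(ins0l b s linPhi) -ins_linearl //.
by congr (ins _ _ _ _); apply/funext => w; rewrite addr0.
Qed.

End Linearity.

(** The part of a double insertion in which neither map feeds the other. The head of the list ends
    [G], ends [H], is an earlier argument of [G] or of [H], or is passed over by both. The maps
    stand in the order [G], [H], so an entry bound for [G] crosses [H]. *)
Fixpoint ins2 (M : lmodType K) (b : bool) (G : seq E -> E) (c : bool)
    (H : seq E -> E) (Phi : seq E -> M) (s : seq E) : M :=
  if s is x :: s' then
    (-1) ^+ c *: ins c H (fun w => Phi (G [:: x] :: w)) s' +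
    ((-1) ^+ b *: ins b G (fun w => Phi (H [:: x] :: w)) s' +
     ((-1) ^+ c *: ins2 (~~ b) (fun u => G (x :: u)) c H Phi s' +
      (ins2 b G (~~ c) (fun u => H (x :: u)) Phi s' +
       (-1) ^+ (b (+) c) *: ins2 b G c H (fun w => Phi (x :: w)) s')))
  else 0.

(** A cochain of arity n + 1 has degree n, so it vanishes on lists whose length has the parity of
    its degree. *)
Definition has_parity b (G : seq E -> E) : Prop :=
  forall u, odd (size u) = b -> G u = 0.

Lemma has_parity_cons b G x : has_parity b G -> has_parity (~~ b) (fun u => G (x :: u)).
Proof. by move=> pG u su; apply: pG; rewrite /= su negbK. Qed.

Lemma ins2_sym (M : lmodType K) b G c H (Phi : seq E -> M) s :
    has_parity b G -> has_parity c H -> multilinear Phi ->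
  ins2 b G c H Phi s = (-1) ^+ (b && c) *: ins2 c H b G Phi s.
Proof.
elim: s b G c H Phi => [|x s IH] b G c H Phi pG pH linPhi /=.
  by rewrite scaler0.
have zero v : v = 0 -> (fun w => Phi (v :: w)) = fun _ => 0.
  by move=> ->; apply/funext => w; apply: (multilinear0 [::] w linPhi).
(* [G [:: x]] can be nonzero only for [b = false], and then the sign to be inserted is 1. *)
have swapG : (-1) ^+ c *: ins c H (fun w => Phi (G [:: x] :: w)) s =
    (-1) ^+ (b && c) *: ((-1) ^+ c *: ins c H (fun w => Phi (G [:: x] :: w)) s).
  by case: b pG {IH} => pG; rewrite ?scale1r // (zero _ (pG [:: x] erefl)) ins0r !scaler0.
have swapH : (-1) ^+ b *: ins b G (fun w => Phi (H [:: x] :: w)) s =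
    (-1) ^+ (b && c) *: ((-1) ^+ b *: ins b G (fun w => Phi (H [:: x] :: w)) s).
  case: c pH {IH swapG} => pH; last by rewrite andbF ?scale1r.
  by rewrite (zero _ (pH [:: x] erefl)) ins0r !scaler0.
rewrite [in LHS]swapG [in LHS]swapH !scalerDr [LHS]addrCA; congr (_ + (_ + _)).
rewrite [RHS]addrCA; congr (_ + _); last congr (_ + _).
- rewrite IH //; last exact: has_parity_cons.
  rewrite !scalerA -!signr_addb; congr (_ ^+ nat_of_bool _ *: _).
  by case: (b) (c) => [] [].
- rewrite IH //; last exact: has_parity_cons.
  rewrite !scalerA -!signr_addb; congr (_ ^+ nat_of_bool _ *: _).
  by case: (b) (c) => [] [].
- rewrite IH //; last exact: multilinear_cons.
  rewrite !scalerA -!signr_addb; congr (_ ^+ nat_of_bool _ *: _).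
  by case: (b) (c) => [] [].
Qed.

Lemma ins_ins (M : lmodType K) b G c H (Phi : seq E -> M) s :
    multilinear G -> has_parity c H -> multilinear Phi ->
  ins c H (ins b G Phi) s = ins (b (+) c) (ins c H G) Phi s + ins2 b G c H Phi s.
Proof.
elim: s b G c H Phi => [|x s IH] b G c H Phi linG pH linPhi /=; first by rewrite addr0.
have linGx := multilinear_cons x linG; have linPhix := multilinear_cons x linPhi.
have pHx := has_parity_cons x pH.
rewrite !insDr insZr !insDl // insZl // !IH // !scalerDr !scaler0 !addr0.
(* The two parities differ only for [c = true], where [H [:: x]] is 0. *)
have -> : ins (~~ (b (+) c)) (fun u => G (H [:: x] :: u)) Phi s =
          ins (~~ b) (fun u => G (H [:: x] :: u)) Phi s.
  case: c pH {pHx} => [pH|_]; last by rewrite addbF.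
  suff -> : (fun u => G (H [:: x] :: u)) = fun _ => 0 by rewrite !ins0l.
  by apply/funext => u; rewrite pH // (multilinear0 [::] u linG).
rewrite !scalerA -!signr_addb.
have -> : c (+) b = b (+) c by rewrite addbC.
have -> : b (+) ~~ c = ~~ (b (+) c) by rewrite addbN.
have -> : ~~ b (+) c = ~~ (b (+) c) by rewrite addNb.
zmod_cancel.
Qed.
End Insertion.

(** * The graded Lie algebra of cochains *)

Section BalavoineLie.
Variables (K : fieldType) (E : lmodType K).
Implicit Types (f g h : seq E -> E) (x u : seq E).

Local Notation odd_ush := (ush (fun _ : E => true)).

Lemma pars_odd (T : eqType) (s : seq T) : pars (fun _ => true) s = odd (size s).
Proof. by elim: s => //= x s ->. Qed.

(** Closed form of the recursion: [j] is the position of the last argument of [g], and the entries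
    before it are unshuffled into the other arguments [u] and the entries [v] passed over. *)
Lemma ins_unshuffle (M : lmodType K) b g (Phi : seq E -> M) x :
    has_parity b g -> multilinear Phi ->
  ins b g Phi x =
  \sum_(j < size x) odd_ush (take j x)
    (fun u v => Phi (v ++ g (rcons u x`_j) :: drop j.+1 x)).
Proof.
elim: x b g Phi => [|x0 x IH] b g Phi pg linPhi /=; first by rewrite big_ord0.
rewrite big_ord_recl /= drop0; congr (_ + _).
rewrite IH ?IH //; [|exact: multilinear_cons|exact: has_parity_cons].
rewrite scaler_sumr -big_split; apply: eq_bigr => j _ /=; congr (_ + _).
rewrite -ushZ; apply: eq_ush => u v _; rewrite pars_odd.
(* The recursion signs a passed entry by the degree of [g], the unshuffle by the length of [u]; the
   two agree unless [g] vanishes on [rcons u _]. *)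
case: (eqVneq (odd (size u)) b) => [->//|ub].
rewrite pg ?size_rcons /=; last by case: (odd _) b ub {pg IH} => [] [].
by rewrite (multilinear0 (x0 :: v) _ linPhi) !scaler0.
Qed.

Lemma cochain_multilinear (n : int) f : is_cochain n f -> multilinear f.
Proof. by case. Qed.

Lemma cochain_size (n : nat) f x : is_cochain n f -> size x != n -> f x = 0.
Proof. by move=> [f0 _] xn; apply: f0 => -[] e; rewrite e eqxx in xn. Qed.

Lemma cochain_parity (n : nat) f : is_cochain n.+1 f -> has_parity (odd n) f.
Proof.
move=> cf u un; apply: (cochain_size cf); apply/eqP => e; move: un; rewrite e /=.
by case: (odd n).
Qed.

Lemma ins_size (m n : nat) f g x :
    is_cochain m.+1 f -> is_cochain n.+1 g -> size x != (m + n).+1 ->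
  ins (odd n) g f x = 0.
Proof.
move=> cf cg xmn; rewrite ins_unshuffle; last first.
- exact: cochain_multilinear cf.
- exact: cochain_parity cg.
rewrite big1 // => j _; rewrite -[RHS](ush0 (fun _ => true) E (take j x)).
apply: eq_ush => u v /perm_size; rewrite size_cat size_takel ?(ltnW (ltn_ord j)) // => uv.
case: (eqVneq (size u) n) => [un|un]; last first.
  rewrite (cochain_size cg) ?size_rcons ?eqSS //.
  by rewrite (multilinear0 _ _ (cochain_multilinear cf)).
rewrite (cochain_size cf) // size_cat /= size_drop; apply: contraNneq xmn => e.
by rewrite -addSn -e -un -addnA [(_ + size u)%N]addnC addnA addnS [(size v + _)%N]addnC uv
  -addSn subnKC.
Qed.

(** In [diamond] the entries passed over come first in the shuffle, in [ins_unshuffle] the arguments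
    of [g] do. Exchanging them by [ush_cocomm] produces the sign with exponent [i * n]. Positions
    below [n] leave too few arguments for [g]. *)
Lemma diamond_ins (m n : nat) f g x :
    is_cochain m.+1 f -> is_cochain n.+1 g -> size x = (m + n).+1 ->
  diamond m n f g x = ins (odd n) g f x.
Proof.
move=> cf cg sx; have linf := cochain_multilinear cf.
rewrite ins_unshuffle //; last exact: cochain_parity cg.
pose F j := odd_ush (take j x) (fun u v => f (v ++ g (rcons u x`_j) :: drop j.+1 x)).
rewrite -(big_mkord xpredT F) (big_cat_nat (n := n)) //=; last first.
  by rewrite sx -addSn leq_addl.
rewrite [X in _ = X + _]big_nat_cond big1 ?add0r => [|j /andP[/andP[_ jn] _]]; last first.
  rewrite -[RHS](ush0 (fun _ => true) E (take j x)); apply: eq_ush => u v /perm_size.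
  rewrite size_cat size_take_min => uv; rewrite (cochain_size cg) ?(multilinear0 _ _ linf) //.
  rewrite size_rcons eqSS neq_ltn (leq_ltn_trans _ jn) //.
  by rewrite (leq_trans (leq_addr (size v) _)) // uv geq_minl.
rewrite -[n in X in _ = X]add0n big_addn sx -addSn addnK big_mkord /diamond.
apply: eq_bigr => i _; rewrite /F [RHS]ush_cocomm.
have le_inx : (i + n <= size x)%N by rewrite sx leqW // leq_add2r -ltnS.
have sz : size (take (i + n) x) == (i + n)%N by rewrite size_takel.
pose t := Tuple sz.
have tE (a : 'I_(i + n)) : tnth t a = x`_a.
  by rewrite (tnth_nth 0) nth_take.
transitivity ((-1 : K) ^+ (i * n) *: odd_ush t (fun a b =>
    if size a == i then f (a ++ g (rcons b x`_(i + n)) :: drop (i + n).+1 x) else 0)).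
  rewrite -(shuffle_ush _ _ (fun a b => f (a ++ g (rcons b _) :: _)) (leq_addr n i)).
  congr (_ *: _); apply: eq_bigr => sg _.
  rewrite -inversions_odd_perm.
  congr (_ *: _).
  rewrite (_ : [seq tnth t (sg a) | a : 'I_(i + n)] = [seq x`_(sg a) | a : 'I_(i + n)]) //.
  by apply: eq_map => a; rewrite tE.
rewrite -ushZ; apply: eq_ush => a b /perm_size; rewrite size_cat (eqP sz) !pars_odd => ab.
case: (eqVneq (size a) i) => ai.
  have -> : size b = n by apply/eqP; rewrite -(eqn_add2l i) -{1}ai ab.
  by rewrite ai -oddM signr_odd.
rewrite (cochain_size cg) ?(multilinear0 _ _ linf) ?scaler0 //.
rewrite size_rcons eqSS; apply: contraNneq ai => bn.
by rewrite -(eqn_add2r n) -{1}bn ab.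
Qed.

(** Both sides vanish off length m + n + 1, so the formula is an equality of functions on all lists
    and can be substituted inside another bracket. *)
Lemma balavoine_ins (m n : nat) f g :
    is_cochain m.+1 f -> is_cochain n.+1 g ->
  balavoine f g = fun x =>
    (- (-1) ^+ (odd m && odd n)) *: ins (odd m) f g x + ins (odd n) g f x.
Proof.
move=> cf cg; apply/funext => x.
case: (eqVneq (size x) (m + n).+1) => sx.
  rewrite (balavoineE cf cg sx) (diamond_ins cf cg) // (diamond_ins cg cf) 1?addnC //.
  by rewrite -oddM signr_odd scaleNr addrC.
rewrite (ins_size cf cg sx) (ins_size cg cf) 1?addnC //  1?addnC // scaler0 addr0.
rewrite /balavoine big1 // => i _.
have sxi : size x = (i + ((size x).-1 - i)).+1.
  by case: (size x) i => [[]//|k i]; rewrite subnKC // -ltnS.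
rewrite (diamond_wrong_degree cf cg sxi); last first.
  case: (eqVneq m i) => [mi|mi]; [right|left] => -[] e.
    by move: sx; rewrite sxi mi -e eqxx.
  by rewrite e eqxx in mi.
rewrite (diamond_wrong_degree cg cf) ?scaler0 ?subr0 //; first by rewrite addnC.
case: (eqVneq m i) => [mi|mi]; [left|right] => -[] e.
  by move: sx; rewrite sxi mi -e eqxx.
by rewrite e eqxx in mi.
Qed.

Lemma balavoine_cochain (m n : nat) f g :
    is_cochain m.+1 f -> is_cochain n.+1 g ->
  is_cochain (m + n).+1 (balavoine f g).
Proof.
move=> cf cg; have linf := cochain_multilinear cf; have ling := cochain_multilinear cg.
rewrite (balavoine_ins cf cg); split => [s sz|s1 s2 c x y].
  have smn : size s != (m + n).+1 by apply: contra_notN sz => /eqP ->.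
  by rewrite (ins_size cf cg smn) (ins_size cg cf) 1?addnC // scaler0 addr0.
rewrite !(ins_multilinear _ linf ling) !(ins_multilinear _ ling linf).
by rewrite !scalerDr addrACA !scalerA mulrC.
Qed.

Lemma balavoineC (m n : nat) f g :
    is_cochain m.+1 f -> is_cochain n.+1 g ->
  balavoine f g = - (-1) ^+ (odd m && odd n) *: balavoine g f.
Proof.
move=> cf cg; rewrite (balavoine_ins cf cg) (balavoine_ins cg cf).
apply/funext => x; rewrite fctE /= scalerDr scalerA mulrNN -signr_addb andbC addbb.
by rewrite scale1r addrC.
Qed.

(** Written as the rule that bracketing with [h] on the right is a graded derivation, the form in
    which iterated brackets [..[q, a_1], .., a_n] use it. *)
Lemma balavoine_jacobi (m n p : nat) f g h :
    is_cochain m.+1 f -> is_cochain n.+1 g -> is_cochain p.+1 h ->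
  balavoine (balavoine f g) h =
  balavoine f (balavoine g h) +
  (-1) ^+ (odd n && odd p) *: balavoine (balavoine f h) g.
Proof.
move=> cf cg ch.
have [linf [ling linh]] := (cochain_multilinear cf,
  (cochain_multilinear cg, cochain_multilinear ch)).
have [pf [pg ph]] := (cochain_parity cf, (cochain_parity cg, cochain_parity ch)).
rewrite (balavoine_ins (balavoine_cochain cf cg) ch).
rewrite (balavoine_ins cf (balavoine_cochain cg ch)).
rewrite (balavoine_ins (balavoine_cochain cf ch) cg).
rewrite !(balavoine_ins cf cg) !(balavoine_ins cg ch) !(balavoine_ins cf ch).
apply/funext => x; rewrite !fctE /=.
rewrite !ins_linearr !ins_linearl // !oddD !ins_ins //.
(* The independent insertions are brought to one order of the inserted maps; they then cancel in
   each of the eight parity cases. *)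
rewrite (ins2_sym _ pg ph linf) (ins2_sym _ pf ph ling) (ins2_sym _ pf pg linh).
have -> : odd n (+) odd m = odd m (+) odd n by rewrite addbC.
have -> : odd p (+) odd m = odd m (+) odd p by rewrite addbC.
have -> : odd p (+) odd n = odd n (+) odd p by rewrite addbC.
case: (odd m) (odd n) (odd p) => [] [] [];
rewrite /= ?(expr0, expr1, opprK, scaleN1r, scale1r, opprD, scalerDr, scalerN); zmod_cancel.
Qed.

End BalavoineLie.

(** * Bidegrees *)

Section BalavoineLinear.
Variables (K : fieldType) (E : lmodType K).
Implicit Types f g : seq E -> E.

Lemma diamond_linearl (m n : nat) c f f' g x :
  diamond m n (c *: f + f') g x = c *: diamond m n f g x + diamond m n f' g x.
Proof.
rewrite /diamond scaler_sumr -big_split; apply: eq_bigr => i _ /=.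
rewrite scalerA mulrC -scalerA -scalerDr; congr (_ *: _).
rewrite scaler_sumr -big_split; apply: eq_bigr => sg _ /=.
by rewrite scalerA mulrC -scalerA -scalerDr.
Qed.

Lemma diamond_linearr (m n : nat) c f g g' x : multilinear f ->
  diamond m n f (c *: g + g') x = c *: diamond m n f g x + diamond m n f g' x.
Proof.
move=> linf; rewrite /diamond scaler_sumr -big_split; apply: eq_bigr => i _ /=.
rewrite scalerA mulrC -scalerA -scalerDr; congr (_ *: _).
rewrite scaler_sumr -big_split; apply: eq_bigr => sg _ /=.
by rewrite scalerA mulrC -scalerA -scalerDr -linf.
Qed.

Lemma balavoine_linearl c f f' g : multilinear g ->
  balavoine (c *: f + f') g = c *: balavoine f g + balavoine f' g.
Proof.
move=> ling; apply/funext => x; rewrite !fctE /balavoine scaler_sumr -big_split.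
apply: eq_bigr => i _ /=; rewrite diamond_linearl diamond_linearr //.
by rewrite !scalerDr !scalerN !scalerA mulrC opprD addrACA.
Qed.

Lemma balavoine_linearr c f g g' : multilinear f ->
  balavoine f (c *: g + g') = c *: balavoine f g + balavoine f g'.
Proof.
move=> linf; apply/funext => x; rewrite !fctE /balavoine scaler_sumr -big_split.
apply: eq_bigr => i _ /=; rewrite diamond_linearl diamond_linearr //.
by rewrite !scalerDr !scalerN !scalerA mulrC opprD addrACA.
Qed.

Lemma balavoine0l g : multilinear g -> balavoine 0 g = 0.
Proof.
move=> ling; have := balavoine_linearl (-1) 0 0 ling.
by rewrite scaler0 addr0 scaleN1r addNr.
Qed.

Lemma balavoine0r f : multilinear f -> balavoine f 0 = 0.
Proof.
move=> linf; have := balavoine_linearr (-1) 0 0 linf.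
by rewrite scaler0 addr0 scaleN1r addNr.
Qed.

Lemma balavoineZl c f g : multilinear g -> balavoine (c *: f) g = c *: balavoine f g.
Proof. by move=> ling; rewrite -[c *: f]addr0 balavoine_linearl // balavoine0l // addr0. Qed.

End BalavoineLinear.

Definition oddz (d : int) : bool := odd `|d|%N.

Lemma oddzD a b : oddz (a + b) = oddz a (+) oddz b.
Proof.
have oddzN (c : nat) : oddz (- c%:Z) = odd c by rewrite /oddz abszN.
have oddzB (c d : nat) : oddz (c%:Z - d%:Z) = odd c (+) odd d.
  rewrite /oddz; case: (leqP d c) => [dc|/ltnW cd].
    by rewrite subzn // absz_nat oddB.
  by rewrite -opprB abszN subzn // absz_nat oddB // addbC.
case: (intP a) (intP b) => [|c|c] [|d|d];
  rewrite ?add0r ?addr0 ?addbF //.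
- by rewrite -PoszD /oddz !absz_nat oddD.
- by rewrite addrC oddzB oddzN addbC.
- by rewrite -opprD -PoszD !oddzN oddD.
Qed.

Lemma oddzM a b : oddz (a * b) = oddz a && oddz b.
Proof. by rewrite /oddz abszM oddM. Qed.

Lemma signz (R : unitRingType) d : (-1 : R) ^ d = (-1) ^+ oddz d.
Proof.
rewrite /oddz signr_odd; case: d => n //.
exact: (invr_sign R n.+1).
Qed.

Section Bidegree.
Variables (K : fieldType) (g V : lmodType K).
Local Notation E := (g * V)%type.
Implicit Types (F G : seq E -> E) (k l : int).

Lemma bideg_cochain k l (n : nat) F : k + l = n -> bideg k l F -> is_cochain n.+1 F.
Proof. by move=> kl [_ + _]; rewrite kl -PoszD addn1. Qed.

Lemma bideg_multilinear k l F : bideg k l F -> multilinear F.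
Proof. by case=> _ [_ linF] _. Qed.

Lemma bideg_neg k l F : k + l < 0 -> bideg k l F -> F = 0.
Proof.
move=> kl [F0 [Fsz _] _]; apply/funext => -[|x s] //; apply: Fsz => /= e.
by move: kl; rewrite -(ltrD2r 1) -e add0r.
Qed.

(* A vector of weight 1 lies in g, a vector of weight 0 lies in V, and the
   only vector of any other weight is 0; C^{k|l} consists of cochains lowering
   the total weight by k. *)
Definition weight (w : int) (e : E) : Prop :=
  (w <> 1 -> e.1 = 0) /\ (w <> 0 -> e.2 = 0).

Definition lowers_weight k F : Prop := forall s : seq (int * E),
  {in s, forall p, weight p.1 p.2} ->
  weight (\sum_(p <- s) p.1 - k) (F (map snd s)).

Lemma weight0 w : weight w 0. Proof. by []. Qed.

Lemma weightD w x y : weight w x -> weight w y -> weight w (x + y).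
Proof.
move=> [x1 x2] [y1 y2]; split => nw /=; first by rewrite x1 // y1 // addr0.
by rewrite x2 // y2 // addr0.
Qed.

Lemma weightZ w (c : K) x : weight w x -> weight w (c *: x).
Proof.
by move=> [x1 x2]; split => nw /=; rewrite ?x1 ?x2 // scaler0.
Qed.

Lemma lowers_weight_cons k G (p : int * E) : weight p.1 p.2 ->
  lowers_weight k G -> lowers_weight (k - p.1) (fun u => G (p.2 :: u)).
Proof.
move=> wp wG s ws; have := wG (p :: s); rewrite big_cons /= opprB.
rewrite addrCA addrA; apply => q; rewrite inE => /predU1P[->//|].
exact: ws.
Qed.

(** Weights make insertion additive without bookkeeping of tensor summands: a value of [G] is an
    entry of some weight, and is 0 if that weight is neither 0 nor 1, so [F] applies to it without
    case distinction. *)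
Lemma ins_lowers_weight b k k' G F :
  lowers_weight k G -> lowers_weight k' F -> lowers_weight (k + k') (ins b G F).
Proof.
move=> + + s; elim: s b k k' G F => [|p s IH] b k k' G F wG wF ws.
  exact: weight0.
have wp : weight p.1 p.2 by apply: ws; rewrite mem_head.
have ws' : {in s, forall p, weight p.1 p.2}.
  by move=> q qs; apply: ws; rewrite inE qs orbT.
rewrite /= big_cons; apply: weightD; last apply: weightD; last apply: weightZ.
- have wGp : weight (p.1 - k) (G [:: p.2]).
    have := wG [:: p]; rewrite big_seq1; apply => q; rewrite inE => /eqP ->.
    exact: wp.
  have := wF ((p.1 - k, G [:: p.2]) :: s); rewrite big_cons /= opprD.
  have -> : p.1 - k + \sum_(j <- s) j.1 - k' = p.1 + \sum_(j <- s) j.1 + (- k - k').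
    lia.
  by apply => q; rewrite inE => /predU1P[->//|]; apply: ws'.
- have := IH (~~ b) _ _ _ _ (lowers_weight_cons wp wG) wF ws'.
  rewrite /=; set S := \sum_(j <- s) j.1.
  suff -> : S - (k - p.1 + k') = p.1 + S - (k + k') by [].
  lia.
- have := IH b _ _ _ _ wG (lowers_weight_cons wp wF) ws'.
  rewrite /=; set S := \sum_(j <- s) j.1.
  suff -> : S - (k + (k' - p.1)) = p.1 + S - (k + k') by [].
  lia.
Qed.

Lemma bideg_weight k l F : bideg k l F -> lowers_weight k F.
Proof.
move=> bF s ws; have [_ [_ linF] pF] := bF.
(* Either some entry is 0 and multilinearity gives 0, or all entries come from the summands and the
   total weight counts those from g. *)
have [|[t [<- <-]]] : 0 \in map snd s \/ exists t,
    map (@summand K g V) t = map snd s /\ (num_g t)%:Z = \sum_(p <- s) p.1.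
- elim: s ws => [_|[w e] s IH ws]; first by right; exists [::]; rewrite big_nil.
  have [||[t [t1 t2]]] := IH; first by move=> q qs; apply: ws; rewrite inE qs orbT.
    by move=> s0; left; rewrite inE s0 orbT.
  have /= [w1 w0] := ws (w, e) (mem_head _ _).
  rewrite /num_g in t2 *.
  case: (eqVneq w 1) => [we|/eqP we].
    right; exists (inl e.1 :: t); rewrite /= t1 big_cons -t2 we; split => //.
    by rewrite /= -w0 ?we //; congr cons; case: (e).
  case: (eqVneq w 0) => [wv|/eqP wv].
    right; exists (inr e.2 :: t); rewrite /= t1 big_cons -t2 wv add0r; split => //.
    by rewrite /= -w1 //; congr cons; case: (e).
  left; have -> : e = 0 by rewrite [e]surjective_pairing w1 // w0.
  by rewrite mem_head.
- move=> /splitPr[s1 s2]; rewrite (multilinear0 _ _ linF); exact: weight0.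
have [p1 p2 p3] := pF t; split => nk.
  case: (eqVneq (num_g t)%:Z k) => [/p2//|/eqP nk'].
  by rewrite p3 // => e; apply: nk; rewrite e addrC addKr.
case: (eqVneq (num_g t)%:Z (k + 1)) => [/p1//|/eqP nk'].
by rewrite p3 // => e; apply: nk; rewrite e subrr.
Qed.

Lemma weight_bideg k l F : F [::] = 0 -> is_cochain (k + l + 1) F ->
  lowers_weight k F -> bideg k l F.
Proof.
move=> F0 cF wF; split => // t.
pose s : seq (int * E) :=
  [seq (if u is inl _ then 1 else 0, summand u) | u <- t].
have -> : map (@summand K g V) t = map snd s by rewrite -map_comp.
have -> : (num_g t)%:Z = \sum_(p <- s) p.1.
  rewrite /s /num_g; elim: (t) => [|u t' IH]; rewrite ?big_nil //= big_cons -IH.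
  by rewrite PoszD; case: u.
have [] := wF s.
  by move=> _ /mapP[[x|v] _ ->]; split => //= /(_ erefl).
set w := \sum_(p <- s) p.1; move=> w1 w0; split=> [e|e|e e'].
- by apply: w0; rewrite e addrC addKr.
- by apply: w1; rewrite e subrr.
- rewrite [LHS]surjective_pairing w1 ?w0 // => e2; [apply: e'|apply: e].
    by rewrite -[w](subrK k) e2 add0r.
  by rewrite -[w](subrK k) e2 addrC.
Qed.

Lemma bideg_linear k l c F G : bideg k l F -> bideg k l G -> bideg k l (c *: F + G).
Proof.
move=> bF bG; have [F0 [Fsz linF] _] := bF; have [G0 [Gsz linG] _] := bG.
apply: weight_bideg; first by rewrite !fctE F0 G0 scaler0 addr0.
  split => [s sz|s1 s2 d x y]; first by rewrite !fctE Fsz // Gsz // scaler0 addr0.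
  by rewrite !fctE linF linG !scalerDr addrACA !scalerA mulrC.
move=> s ws; rewrite !fctE; apply: weightD; first apply: weightZ.
  exact: bideg_weight bF s ws.
exact: bideg_weight bG s ws.
Qed.

Lemma bideg0 k l : bideg k l (0 : seq E -> E).
Proof.
apply: weight_bideg => [//||s _]; last exact: weight0.
split=> [//|s1 s2 c x y]; transitivity (c *: (0 : E) + 0) => //.
by rewrite scaler0 addr0.
Qed.

Lemma bidegZ k l c F : bideg k l F -> bideg k l (c *: F).
Proof. by move=> bF; rewrite -[_ *: _]addr0; apply/bideg_linear/bideg0. Qed.

(** The number of entries from g equals neither k nor k + 1, both being negative; multilinearity
    extends the vanishing to all lists. This makes [afrak] abelian and bounds the derived
    brackets. *)
Lemma bideg_lt k l F : k < -1 -> bideg k l F -> F = 0.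
Proof.
move=> k1 bF; have [_ [_ linF] pF] := bF; apply/funext => s.
suff pure s' (t : seq (g + V)) : F (map (@summand K g V) t ++ s') = 0.
  exact: (pure s [::]).
elim: s' t => [|x s' IH] t.
  rewrite cats0; have [_ _ ->] // := pF t => e; move: k1.
    by rewrite -(ltrD2r 1) -e addNr.
  by rewrite -e.
have -> : x = 1 *: (x.1, 0) + (0, x.2) :> E.
  by rewrite scale1r [RHS]surjective_pairing /= addr0 add0r; case: (x).
rewrite linF -!cat_rcons.
have r u : rcons (map (@summand K g V) t) (summand u) = map (@summand K g V) (rcons t u).
  by rewrite map_rcons.
by rewrite (r (inl x.1)) (r (inr x.2)) !IH scaler0 addr0.
Qed.

Lemma int_case (d : int) : d < 0 \/ exists n : nat, d = n.
Proof. by case: d => n; [right; exists n|left]. Qed.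

Lemma balavoine_bideg k l k' l' F G : bideg k l F -> bideg k' l' G ->
  bideg (k + k') (l + l') (balavoine F G).
Proof.
move=> bF bG; have [linF linG] := (bideg_multilinear bF, bideg_multilinear bG).
case: (int_case (k + l)) => [neg|[m km]].
  by rewrite (bideg_neg neg bF) balavoine0l //; apply: bideg0.
case: (int_case (k' + l')) => [neg|[n kn]].
  by rewrite (bideg_neg neg bG) balavoine0r //; apply: bideg0.
have [cF cG] := (bideg_cochain km bF, bideg_cochain kn bG).
apply: weight_bideg; first by rewrite /balavoine big_ord0.
  by rewrite addrACA km kn -!PoszD addn1; apply: balavoine_cochain.
move=> s ws; rewrite (balavoine_ins cF cG); apply: weightD; first apply: weightZ.
  exact: ins_lowers_weight (bideg_weight bF) (bideg_weight bG) s ws.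
rewrite [k + _]addrC.
exact: ins_lowers_weight (bideg_weight bG) (bideg_weight bF) s ws.
Qed.

Lemma bideg_balavoineC k l k' l' F G : bideg k l F -> bideg k' l' G ->
  balavoine F G = - (-1) ^+ (oddz (k + l) && oddz (k' + l')) *: balavoine G F.
Proof.
move=> bF bG; have [linF linG] := (bideg_multilinear bF, bideg_multilinear bG).
case: (int_case (k + l)) => [neg|[m km]].
  by rewrite (bideg_neg neg bF) balavoine0l // balavoine0r // scaler0.
case: (int_case (k' + l')) => [neg|[n kn]].
  by rewrite (bideg_neg neg bG) balavoine0l // balavoine0r // scaler0.
by rewrite km kn; apply: balavoineC (bideg_cochain km bF) (bideg_cochain kn bG).
Qed.

Lemma bideg_jacobi k l k' l' k'' l'' F G H :
    bideg k l F -> bideg k' l' G -> bideg k'' l'' H ->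
  balavoine (balavoine F G) H =
  balavoine F (balavoine G H) +
  (-1) ^+ (oddz (k' + l') && oddz (k'' + l'')) *: balavoine (balavoine F H) G.
Proof.
move=> bF bG bH; have linF := bideg_multilinear bF.
have linG := bideg_multilinear bG; have linH := bideg_multilinear bH.
have lFG := bideg_multilinear (balavoine_bideg bF bG).
have lFH := bideg_multilinear (balavoine_bideg bF bH).
have lGH := bideg_multilinear (balavoine_bideg bG bH).
case: (int_case (k + l)) => [neg|[m km]].
  rewrite (bideg_neg neg bF) !(balavoine0l linG) !(balavoine0l linH) !balavoine0l //.
  by rewrite scaler0 addr0.
case: (int_case (k' + l')) => [neg|[n kn]].
  rewrite (bideg_neg neg bG) in lFG lGH *.
  by rewrite !(balavoine0r linF) !(balavoine0l linH) !balavoine0r // scaler0 addr0.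
case: (int_case (k'' + l'')) => [neg|[p kp]].
  rewrite (bideg_neg neg bH) in lFH lGH *.
  rewrite !(balavoine0r linF) !(balavoine0r linG) !balavoine0r // balavoine0l //.
  by rewrite scaler0 addr0.
rewrite kn kp; apply: balavoine_jacobi (bideg_cochain km bF) (bideg_cochain kn bG) _.
exact: bideg_cochain kp bH.
Qed.

Lemma projP_linear c F G : projP (c *: F + G) = c *: projP F + projP G.
Proof.
apply/funext => s; rewrite fctE /projP !fctE; apply/eqP.
by rewrite xpair_eqE /= scaler0 addr0 !eqxx.
Qed.

Lemma projP0 : projP (0 : seq E -> E) = 0.
Proof. by []. Qed.

Lemma projPZ c F : projP (c *: F) = c *: projP F.
Proof. by rewrite -[c *: F]addr0 projP_linear projP0 addr0. Qed.

Variant projP_spec k F : (seq E -> E) -> Prop :=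
| ProjPZero of F = 0 : projP_spec k F 0
| ProjPId of k = -1 : projP_spec k F F
| ProjPKer of (0 <= k)%R : projP_spec k F 0.

Lemma projPP k l F : bideg k l F -> projP_spec k F (projP F).
Proof.
move=> bF; case: (ltrP k (-1)) => [k1|k1].
  by rewrite (bideg_lt k1 bF); apply: ProjPZero.
case: (ltrP k 0) => [k0|k0]; last by rewrite (projP_ker k0 bF); apply: ProjPKer.
have ke : k = -1 by apply/eqP; rewrite eq_le k1 andbT -ltzD1 addNr.
rewrite (@projP_afrak _ _ _ (l - 1)); first exact: ProjPId.
by rewrite /afrak subrK -ke.
Qed.

Lemma projP_bideg k l F : bideg k l F -> bideg (-1) (k + l + 1) (projP F).
Proof.
move=> bF; case: (projPP bF) => [_|k1|_]; [exact: bideg0| |exact: bideg0].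
by move: bF; rewrite k1 addrC addrA subrr add0r.
Qed.

(** For [k] and [k'] nonnegative all terms vanish, the kernel of P being closed under the bracket;
    for both equal to -1 they vanish since the bracket has first bidegree -2. In the mixed case one
    term on the right is the left side and the other is 0. *)
Lemma projP_balavoine k l k' l' F G : bideg k l F -> bideg k' l' G ->
  projP (balavoine F G) =
  projP (balavoine (projP F) G) + projP (balavoine F (projP G)).
Proof.
move=> bF bG; have [linF linG] := (bideg_multilinear bF, bideg_multilinear bG).
have bFG := balavoine_bideg bF bG.
have linPG := bideg_multilinear (projP_bideg bG).
case: (projPP bF) => [F0|k1|k0].
- by rewrite F0 !balavoine0l // projP0 addr0.
- case: (projPP bG) linPG => [G0|k'1|k'0] _; rewrite ?G0 ?balavoine0r // ?projP0 ?addr0 //.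
  by rewrite (bideg_lt _ bFG) ?projP0 ?addr0 // k1 k'1.
- rewrite balavoine0l // projP0 add0r.
  case: (projPP bG) => [G0|k'1|k'0]; rewrite ?G0 ?balavoine0r //.
  by rewrite (projP_ker _ bFG) // addr_ge0.
Qed.

End Bidegree.

(** * Derived brackets *)

Section ExtractExtra.
Variables (K : fieldType) (T : eqType) (par : T -> bool).

Lemma extract_linear (M N : lmodType K) (f : M -> N) s (Phi : T -> seq T -> M) :
  (forall c x y, f (c *: x + y) = c *: f x + f y) ->
  f (extract par s Phi) = extract par s (fun y r => f (Phi y r)).
Proof.
move=> linf; have f0 : f 0 = 0.
  by have := linf (-1) 0 0; rewrite scaler0 addr0 scaleN1r addNr.
have fD x y : f (x + y) = f x + f y by rewrite -[x]scale1r linf !scale1r.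
have fZ c x : f (c *: x) = c *: f x by rewrite -[c *: x]addr0 linf f0 addr0.
elim: s Phi => [|x s IH] Phi //=; rewrite fD IH; congr (_ + _).
by apply: eq_extract => y r _; rewrite fZ.
Qed.

Lemma ush_linear (M N : lmodType K) (f : M -> N) s (Phi : seq T -> seq T -> M) :
  (forall c x y, f (c *: x + y) = c *: f x + f y) ->
  f (ush par s Phi) = ush par s (fun a b => f (Phi a b)).
Proof.
move=> linf; elim: s Phi => [|x s IH] Phi //=.
rewrite -[X in f (X + _)]scale1r linf scale1r !IH; congr (_ + _).
apply: eq_ush => a b _; have f0 : f 0 = 0.
  by have := linf (-1) 0 0; rewrite scaler0 addr0 scaleN1r addNr.
by rewrite -[_ *: _]addr0 linf f0 addr0.
Qed.

Lemma extract_closed (M : lmodType K) (A : M -> Prop) s (Phi : T -> seq T -> M) :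
  A 0 -> (forall c x y, A x -> A y -> A (c *: x + y)) ->
  (forall y r, perm_eq (y :: r) s -> A (Phi y r)) -> A (extract par s Phi).
Proof.
move=> A0 Alin; elim: s Phi => [|x s IH] Phi APhi; first exact: A0.
rewrite /=.
rewrite -[Phi x s]scale1r; apply: (Alin); first by apply: (APhi).
apply: IH => y r yr; rewrite -[_ *: _]addr0; apply: Alin => //; apply: APhi.
by rewrite -(cat1s y) -(cat1s x r) perm_catCA /= perm_cons.
Qed.

Lemma ush_pairE (M N : lmodType K) s (Phi : seq T -> seq T -> M * N) :
  ush par s Phi =
  (ush par s (fun a b => (Phi a b).1), ush par s (fun a b => (Phi a b).2)).
Proof.
elim: s Phi => [|x s IH] Phi /=; first by case: (Phi _ _).
by rewrite !IH.
Qed.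

End ExtractExtra.

Section GradedLists.
Variables (K : fieldType) (W : lmodType K) (X : int -> set W).
Local Notation U := (int * W)%type.
Implicit Types (s t : seq U) (p u : U).

Definition parU u : bool := oddz u.1.

Lemma tdeg_nil : tdeg ([::] : seq U) = 0. Proof. exact: big_nil. Qed.

Lemma tdeg_cons p s : tdeg (p :: s) = p.1 + tdeg s. Proof. exact: big_cons. Qed.

Lemma tdeg_perm s t : perm_eq s t -> tdeg s = tdeg t. Proof. exact: perm_big. Qed.

Lemma oddz_tdeg s : oddz (tdeg s) = pars parU s.
Proof. by elim: s => [|p s IH] /=; rewrite ?tdeg_nil // tdeg_cons oddzD IH. Qed.

Lemma homog_perm s t : perm_eq s t -> homog X t -> homog X s.
Proof. by move=> st ht p; rewrite (perm_mem st); apply: ht. Qed.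

Lemma homog_cons p s : homog X (p :: s) <-> X p.1 p.2 /\ homog X s.
Proof.
split=> [h|[hp hs] u]; last by rewrite inE => /predU1P[->//|/hs].
by split=> [|u us]; apply: h; rewrite inE ?eqxx // us orbT.
Qed.

Lemma homog_cat s t : homog X (s ++ t) <-> homog X s /\ homog X t.
Proof.
split=> [h|[hs ht] u]; last by rewrite mem_cat => /orP[/hs|/ht].
by split=> u us; apply: h; rewrite mem_cat us ?orbT.
Qed.

End GradedLists.

Arguments homog_cons {K W X} p s.
Arguments homog_cat {K W X} s t.

Section DerivedBrackets.
Variables (K : fieldType) (g V : lmodType K).
Local Notation E := (g * V)%type.
Local Notation C := (seq E -> E).
Local Notation W := (C * C)%type.
Local Notation U := (int * W)%type.
Local Notation X := (@Lshift K g V).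
Implicit Types (q x y : C) (s t r a b : seq U) (p u : U).

Local Notation parU := (@parU K W).
Local Notation pars := (pars parU).
Local Notation ush := (ush parU).
Local Notation extract := (extract parU).

Definition iterbr q s : C := foldl (@balavoine K E) q [seq p.2.2 | p <- s].

Lemma iterbr_cons q p s : iterbr q (p :: s) = iterbr (balavoine q p.2.2) s.
Proof. by []. Qed.

Lemma homog_bidegL d (w : W) : X d w -> bideg (d + 1) 0 w.1.
Proof. by case. Qed.

Lemma homog_bidegA d (w : W) : X d w -> bideg (-1) (d + 1) w.2.
Proof. by case. Qed.

Lemma homog_multiA d (w : W) : X d w -> multilinear w.2.
Proof. by move/homog_bidegA/bideg_multilinear. Qed.

Lemma iterbr_bideg k l q s : bideg k l q -> homog X s ->
  bideg (k - (size s)%:Z) (l + tdeg s + (size s)%:Z) (iterbr q s).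
Proof.
elim: s k l q => [|p s IH] k l q bq; first by rewrite tdeg_nil subr0 !addr0.
move=> /homog_cons[hp hs]; rewrite iterbr_cons tdeg_cons /=.
have := IH _ _ _ (balavoine_bideg bq (homog_bidegA hp)) hs.
set S := tdeg s; set n := size s.
have -> : k + -1 - n%:Z = k - n.+1%:Z by lia.
by have -> : l + (p.1 + 1) + S + n%:Z = l + (p.1 + S) + n.+1%:Z by lia.
Qed.

Lemma iterbr_linear c q q' s : homog X s ->
  iterbr (c *: q + q') s = c *: iterbr q s + iterbr q' s.
Proof.
elim: s q q' => [|p s IH] q q' //= /homog_cons[hp hs].
by rewrite !iterbr_cons balavoine_linearl ?IH //; apply: homog_multiA hp.
Qed.

Lemma iterbr0 s : homog X s -> iterbr 0 s = 0.
Proof.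
move=> hs; have := iterbr_linear (-1) 0 0 hs.
by rewrite scaler0 addr0 scaleN1r addNr.
Qed.

Lemma iterbrZ c q s : homog X s -> iterbr (c *: q) s = c *: iterbr q s.
Proof. by move=> hs; rewrite -[c *: q]addr0 iterbr_linear // iterbr0 // addr0. Qed.

Lemma iterbrD q q' s : homog X s -> iterbr (q + q') s = iterbr q s + iterbr q' s.
Proof. by move=> hs; rewrite -[q]scale1r iterbr_linear // !scale1r. Qed.

(** [a, a'] has first bidegree -2 and is 0, so the Jacobi identity reduces to the exchange of the
    two elements of a. *)
Lemma balavoine_swap k l q d e (w w' : W) : bideg k l q -> X d w -> X e w' ->
  balavoine (balavoine q w.2) w'.2 =
  (-1) ^+ (oddz d && oddz e) *: balavoine (balavoine q w'.2) w.2.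
Proof.
move=> bq /homog_bidegA bw /homog_bidegA bw'.
rewrite (bideg_jacobi bq bw bw') (bideg_lt _ (balavoine_bideg bw bw')) //.
rewrite balavoine0r ?add0r; last exact: bideg_multilinear bq.
by rewrite -[X in oddz X && _]addrC -[X in _ && oddz X]addrC !addrK.
Qed.

Lemma iterbr_swap k l q s1 p u s2 : bideg k l q -> homog X (s1 ++ p :: u :: s2) ->
  iterbr q (s1 ++ p :: u :: s2) =
  (-1) ^+ (parU p && parU u) *: iterbr q (s1 ++ u :: p :: s2).
Proof.
elim: s1 k l q => [|p1 s1 IH] k l q bq /=.
  move=> /homog_cons[hp /homog_cons[hu hs]].
  by rewrite !iterbr_cons (balavoine_swap bq hp hu) iterbrZ.
by move=> /homog_cons[hp hs]; rewrite !iterbr_cons; apply: IH hs;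
  apply: balavoine_bideg bq (homog_bidegA hp).
Qed.

Lemma iterbr_last k l q d (w : W) s : bideg k l q -> X d w -> homog X s ->
  balavoine (iterbr q s) w.2 =
  (-1) ^+ (oddz d && pars s) *: iterbr (balavoine q w.2) s.
Proof.
move=> + hw; elim: s k l q => [|p s IH] k l q bq; first by rewrite andbF scale1r.
move=> /homog_cons[hp hs]; rewrite !iterbr_cons.
rewrite (IH _ _ _ (balavoine_bideg bq (homog_bidegA hp)) hs).
rewrite (balavoine_swap bq hp hw) iterbrZ // scalerA -signr_addb /=.
congr (_ ^+ nat_of_bool _ *: _); rewrite /parU.
by case: (oddz d) (oddz p.1) (pars s) => [] [] [].
Qed.

(** Each element of the list acts on [x] or on [y]; those acting on [x] cross [y] on the way, whence
    the sign. *)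
Lemma iterbr_leibniz k l k' l' x y s : bideg k l x -> bideg k' l' y -> homog X s ->
  iterbr (balavoine x y) s =
  ush s (fun a b =>
    (-1) ^+ (oddz (k' + l') && pars a) *: balavoine (iterbr x a) (iterbr y b)).
Proof.
elim: s k l k' l' x y => [|p s IH] k l k' l' x y bx by'.
  by rewrite /= andbF scale1r.
move=> /homog_cons[hp hs]; rewrite iterbr_cons /=.
have bp := homog_bidegA hp.
rewrite (bideg_jacobi bx by' bp) iterbrD // iterbrZ // addrC.
rewrite (IH _ _ _ _ _ _ bx (balavoine_bideg by' bp) hs).
rewrite (IH _ _ _ _ _ _ (balavoine_bideg bx bp) by' hs) -ushZ.
have odp : oddz (-1 + (p.1 + 1)) = parU p by rewrite addrC addrK.
have odyp : oddz (k' + -1 + (l' + (p.1 + 1))) = oddz (k' + l') (+) parU p.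
  by rewrite addrACA [LHS]oddzD odp.
congr (_ + _); apply: eq_ush => a b _; rewrite scalerA -signr_addb;
  congr (_ ^+ nat_of_bool _ *: _); rewrite ?odp ?odyp;
  by case: (oddz (k' + l')) (parU p) (pars a) => [] [] [].
Qed.

Definition derU s : C := extract s (fun u r => projP (iterbr u.2.1 r)).

Lemma extract_sum s (Phi : U -> seq U -> C) :
  extract s Phi = \sum_(j < size s)
    (let u := nth (0, (0, 0)) s j in
     (-1) ^ (u.1 * tdeg (take j s)) *: Phi u (take j s ++ drop j.+1 s)).
Proof.
elim: s Phi => [|p s IH] Phi /=; first by rewrite big_ord0.
rewrite big_ord_recl /= tdeg_nil mulr0 expr0z scale1r drop0 IH; congr (_ + _).
apply: eq_bigr => j _; rewrite !add0n /= tdeg_cons scalerA !signz -signr_addb.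
by rewrite !oddzM oddzD oddz_tdeg /parU; case: (oddz _) (oddz _) (pars _) => [] [] [].
Qed.

(** An element of C^{k|0} that P does not kill for its bidegree has k = -1, hence arity 0, and is 0.
    Thus [derU] agrees with [brackets] on lists of length 1. *)
Lemma projP_single p : X p.1 p.2 -> projP p.2.1 = 0.
Proof.
move=> hp; case: (projPP (homog_bidegL hp)) => // p1.
suff -> : p.2.1 = 0 by [].
by apply: bideg_neg (homog_bidegL hp); rewrite p1.
Qed.

Lemma bracketsE s : homog X s -> brackets s = (brLprime s, derU s).
Proof.
move=> hs; rewrite /brackets /derU extract_sum.
case: s hs => [|p [|u s]] hs //; first by rewrite big_ord0.
have hp : X p.1 p.2 by have [] := (homog_cons p [::]).1 hs.
by rewrite big_ord1 /derived /= (projP_single hp) scaler0.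
Qed.

Lemma brackets_nil : brackets ([::] : seq U) = 0. Proof. by []. Qed.

Lemma brLprime_bideg s : homog X s -> bideg (tdeg s + 1 + 1) 0 (brLprime s).
Proof.
case: s => [|[d1 [q1 w1]] [|[d2 [q2 w2]] [|? ?]]] hs; try exact: bideg0.
move: hs => /homog_cons[/homog_bidegL /= h1 /homog_cons[/homog_bidegL /= h2 _]].
rewrite !tdeg_cons tdeg_nil /=; apply: bidegZ.
have := balavoine_bideg h1 h2.
by have -> : d1 + 1 + (d2 + 1) = d1 + (d2 + 0) + 1 + 1 by lia.
Qed.

Lemma derU_bideg s : homog X s -> bideg (-1) (tdeg s + 1 + 1) (derU s).
Proof.
move=> hs; apply: extract_closed => [|c x y|u r ur]; first exact: bideg0.
  exact: bideg_linear.
have [hu hr] := (homog_cons _ _).1 (homog_perm ur hs).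
have := projP_bideg (iterbr_bideg (homog_bidegL hu) hr).
rewrite -(tdeg_perm ur) tdeg_cons; set n := (size r)%:Z; set S := tdeg r.
by have -> : u.1 + 1 - n + (0 + S + n) + 1 = u.1 + S + 1 + 1 by lia.
Qed.

Lemma brackets_degree s : homog X s -> X (tdeg s + 1) (brackets s).
Proof.
by move=> hs; rewrite bracketsE //; split; [apply: brLprime_bideg|apply: derU_bideg].
Qed.

End DerivedBrackets.

(** * The Jacobi identity of the derived brackets *)

Section DerivedJacobi.
Variables (K : fieldType) (charK0 : has_pchar0 K) (g V : lmodType K).
Local Notation E := (g * V)%type.
Local Notation C := (seq E -> E).
Local Notation W := (C * C)%type.
Local Notation U := (int * W)%type.
Local Notation X := (@Lshift K g V).
Implicit Types (q x y : C) (s t r a b : seq U) (p u : U).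

Local Notation parU := (@parU K W).
Local Notation pars := (pars parU).
Local Notation ush := (ush parU).
Local Notation extract := (extract parU).

Definition br2 (p u : U) : C := (-1) ^+ oddz (p.1 + 1) *: balavoine p.2.1 u.2.1.

Lemma brLprimeE s : brLprime s = if s is [:: p; u] then br2 p u else 0.
Proof.
by case: s => [|[d [q w]] [|[e [q' w']] [|? ?]]] //=; rewrite /br2 signz.
Qed.

Lemma br2C p u : X p.1 p.2 -> X u.1 u.2 ->
  br2 u p = (-1) ^+ (parU p && parU u) *: br2 p u.
Proof.
move=> /homog_bidegL bp /homog_bidegL bu.
rewrite /br2 (bideg_balavoineC bu bp) !addr0 scalerA scalerA.
rewrite mulrN -!signr_addb -signrN; congr (_ ^+ nat_of_bool _ *: _).
by rewrite !oddzD /parU; case: (oddz u.1) (oddz p.1) => [] [].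
Qed.

Lemma derU_cons d (w : W) s : X d w -> homog X s ->
  derU ((d, w) :: s) = projP (iterbr w.1 s) +
    extract s (fun u r =>
      (-1) ^+ (oddz d && parU u) *: projP (iterbr (balavoine u.2.1 w.2) r)).
Proof. by []. Qed.

(** The terms of the Jacobi identity in which [p] supplies the L' element of the inner bracket and
    [u] that of the outer one. The sign belongs to drawing [p] from the list first and [u]
    second. *)
Definition nested (p u : U) (r : seq U) : C :=
  (-1) ^+ (parU p && parU u (+) parU u) *:
    ush r (fun a b => projP (iterbr (balavoine u.2.1 (projP (iterbr p.2.1 a))) b)).

Lemma outer_derived t : homog X t ->
  ush t (fun a b => extract b (fun u b' =>
    (-1) ^+ (oddz (tdeg a + 1) && parU u) *:
      projP (iterbr (balavoine u.2.1 (derU a)) b'))) =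
  extract t (fun p r => extract r (nested p)).
Proof.
move=> ht.
transitivity (ush t (fun a b => extract b (fun u b' => extract a (fun p a' =>
    (-1) ^+ (oddz (tdeg a + 1) && parU u) *:
      projP (iterbr (balavoine u.2.1 (projP (iterbr p.2.1 a'))) b'))))).
  apply: eq_ush => a b ab; apply: eq_extract => u b' ub'.
  have [ha hb] := (homog_cat _ _).1 (homog_perm ab ht).
  have [hu hb'] := (homog_cons _ _).1 (homog_perm ub' hb).
  rewrite extractZ; congr (_ *: _).
  rewrite /derU (@extract_linear _ _ parU _ _
    (fun y => projP (iterbr (balavoine u.2.1 y) b'))) //.
  move=> c y y'; rewrite balavoine_linearr ?iterbr_linear ?projP_linear //.
  exact: bideg_multilinear (homog_bidegL hu).
rewrite ush_extractr.
transitivity (extract t (fun u r => ush r (fun a b => extract a (fun p a' =>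
    (-1) ^+ parU u *:
      projP (iterbr (balavoine u.2.1 (projP (iterbr p.2.1 a'))) b))))).
  apply: eq_extract => u r ur; apply: eq_ush => a b ab; rewrite -extractZ.
  apply: eq_extract => p a' pa'; rewrite scalerA -signr_addb.
  congr (_ ^+ nat_of_bool _ *: _).
  rewrite oddzD oddz_tdeg -(pars_perm parU pa') /=.
  have -> : oddz 1 = true by []; by case: (parU u) (parU p) (pars a') => [] [] [].
under eq_extract => u r ur do rewrite ush_extractl.
rewrite extract_extract_sym; apply: eq_extract => p r pr; apply: eq_extract => u r' ur'.
rewrite -ushZ /nested -ushZ; apply: eq_ush => a b _; rewrite scalerA -signr_addb.
by congr (_ ^+ nat_of_bool _ *: _); case: (parU u) (parU p) => [] [].
Qed.

(* Voronov's identity P[x, y] = P[Px, y] + P[x, Py] applied to the Leibniz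
   expansion of the iterated bracket of [p, u]. *)
Lemma br2_nested p u r : X p.1 p.2 -> X u.1 u.2 -> homog X r ->
  projP (iterbr (br2 p u) r) =
  - nested p u r - (-1) ^+ (parU p && parU u) *: nested u p r.
Proof.
move=> hp hu hr; have [bp bu] := (homog_bidegL hp, homog_bidegL hu).
have bproj v a : X v.1 v.2 -> homog X a ->
    bideg (-1) (v.1 + 1 + tdeg a + 1) (projP (iterbr v.2.1 a)).
  move=> hv ha; have := projP_bideg (iterbr_bideg (homog_bidegL hv) ha).
  set n := (size a)%:Z; set S := tdeg a.
  by have -> : v.1 + 1 - n + (0 + S + n) + 1 = v.1 + 1 + S + 1 by lia.
(* Bracketing at the end with an element of a agrees up to sign with bracketing at the start; a pair
   with first component 0 presents the projection as such an element. *)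
have last_proj v w a b : X v.1 v.2 -> X w.1 w.2 -> homog X a -> homog X b ->
    balavoine (iterbr v.2.1 a) (projP (iterbr w.2.1 b)) =
    (-1) ^+ (oddz (w.1 + 1 + tdeg b) && pars a) *:
      iterbr (balavoine v.2.1 (projP (iterbr w.2.1 b))) a.
  move=> hv hw ha hb; have bw := bproj w b hw hb.
  apply: (@iterbr_last _ _ _ _ _ _ _ (0, _) _ (homog_bidegL hv) _ ha).
  by split=> //; apply: bideg0.
rewrite /br2 iterbrZ // (iterbr_leibniz bp bu hr) addr0 -ushZ.
rewrite (@ush_linear _ _ parU _ _ (@projP K g V)); last exact: projP_linear.
(* The second nested sum has the two parts in exchanged roles; cocommutativity allows a comparison
   with the Leibniz expansion term by term. *)
rewrite /nested [in X in - _ - X]ush_cocomm -!ushZ -!scaleN1r -!ushZ -ushD.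
apply: eq_ush => a b ab; have [ha hb] := (homog_cat _ _).1 (homog_perm ab hr).
rewrite !projPZ (projP_balavoine (iterbr_bideg bp ha) (iterbr_bideg bu hb)).
rewrite (last_proj p u) // (bideg_balavoineC (bproj p a hp ha) (iterbr_bideg bu hb)).
rewrite (last_proj u p) // scaleNr !projPZ !scalerDr.
have -> : oddz (-1 + (p.1 + 1 + tdeg a + 1)) = parU p (+) true (+) pars a.
  by rewrite addrC addrK oddzD oddz_tdeg oddzD.
have -> : oddz (u.1 + 1 - (size b)%:Z + (0 + tdeg b + (size b)%:Z)) = parU u (+) true (+) pars b.
  have -> : u.1 + 1 - (size b)%:Z + (0 + tdeg b + (size b)%:Z) = u.1 + 1 + tdeg b by lia.
  by rewrite oddzD oddz_tdeg oddzD.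
have oppC (v : C) : - v = (-1) ^+ true *: v by rewrite expr1 scaleN1r.
rewrite !oddzD !oddz_tdeg !scaleN1r !oppC !projPZ !scalerA -!signr_addb.
have -> : oddz 1 = true by [].
rewrite -/(parU p) -/(parU u).
congr (_ ^+ nat_of_bool _ *: _ + _ ^+ nat_of_bool _ *: _).
  by case: (parU p) (parU u) (pars a) (pars b) => [] [] [] [].
by case: (parU p) (parU u) (pars a) (pars b) => [] [] [] [].
Qed.

(** The inner bracket enters the outer one through its L' component, nonzero for two inner entries
    only, or through its a component. By [br2_nested] the first contribution cancels the second. *)
Lemma jacobi_snd t : homog X t ->
  ush t (fun a b => derU ((tdeg a + 1, brackets a) :: b)) = 0.
Proof.
move=> ht; pose F p u r := projP (iterbr (br2 p u) r).
have -> : ush t (fun a b => derU ((tdeg a + 1, brackets a) :: b)) =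
    ush t (fun a b => if a is [:: p; u] then F p u b else 0) +
    extract t (fun p r => extract r (nested p)).
  rewrite -outer_derived // -ushD; apply: eq_ush => a b ab.
  have [ha hb] := (homog_cat _ _).1 (homog_perm ab ht).
  rewrite derU_cons //; last exact: brackets_degree.
  rewrite (bracketsE ha) /= brLprimeE; congr (_ + _).
  by case: (a) => [|p [|u [|? ?]]]; rewrite ?iterbr0.
have two : (2%:R : K) != 0 by rewrite ((pcharf0P K).1 charK0).
(* Doubling passes to ordered pairs, over which the two [nested] terms of [br2_nested] have the same
   sum [N]. *)
apply: (scalerI two); rewrite scaler0 scaler_nat mulrnDl ush_pair; last first.
  move=> p u r pur.
  have /homog_cons[hp /homog_cons[hu hr]] := homog_perm pur ht.
  by rewrite /F (br2C hp hu) iterbrZ // projPZ.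
set N := extract t (fun p r => extract r (nested p)).
suff -> : extract t (fun p r => extract r (F p)) = -1 *: (N + N).
  by rewrite scaleN1r mulr2n addNr.
rewrite {2}/N [X in _ = -1 *: (_ + X)]extract_extract_sym -extractD -extractZ.
apply: eq_extract => p r pr; rewrite -extractD -extractZ; apply: eq_extract => u r' ur.
have [hp hr] := (homog_cons _ _).1 (homog_perm pr ht).
have [hu hr'] := (homog_cons _ _).1 (homog_perm ur hr).
by rewrite /F br2_nested // scaleN1r opprD.
Qed.

(** [brLprime] takes two entries at each level, so only lists of length 3 matter, and there this is
    the Jacobi identity in shifted signs. *)
Lemma jacobi_fst t : homog X t ->
  ush t (fun a b => brLprime ((tdeg a + 1, brackets a) :: b)) = 0.
Proof.
move=> ht; have zero a b : perm_eq (a ++ b) t -> size t != 3 ->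
    brLprime ((tdeg a + 1, brackets a) :: b) = 0.
  move=> ab; rewrite -(perm_size ab) size_cat brLprimeE.
  have [_ hb] := (homog_cat _ _).1 (homog_perm ab ht).
  case: b ab hb => [|u [|? ?]] //= ab /homog_cons[hu _] sz.
  rewrite /br2 /= brLprimeE; case: a ab sz => [|p [|p' [|? ?]]] //= ab sz;
    rewrite balavoine0l ?scaler0 //; exact: bideg_multilinear (homog_bidegL hu).
case: (eqVneq (size t) 3) => [|t3]; last first.
  by rewrite -[RHS](ush0 parU C t); apply: eq_ush => a b /zero; apply.
case: t ht {zero} => [|p [|u [|v [|? ?]]]] // /homog_cons[/homog_bidegL bp].
move=> /homog_cons[/homog_bidegL bu /homog_cons[/homog_bidegL bv _]] _.
case: p u v bp bu bv => [d1 [q1 w1]] [d2 [q2 w2]] [d3 [q3 w3]] /= b1 b2 b3.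
rewrite !scaler0 !add0r !addr0 !tdeg_cons !tdeg_nil /= !signz.
rewrite !balavoineZl; try by [apply: bideg_multilinear b1 | apply: bideg_multilinear b2
  | apply: bideg_multilinear b3].
rewrite (bideg_balavoineC (balavoine_bideg b2 b3) b1) (bideg_jacobi b1 b2 b3).
rewrite !scalerA -!mulrA -!signr_addb !addr0 !oddzD.
have -> : oddz 1 = true by [].
rewrite /parU /=.
case: (oddz d1) (oddz d2) (oddz d3) => [] [] [];
rewrite /= ?(expr0, expr1, opprK, scaleN1r, scale1r, opprD, scalerDr, scalerN,
  mulN1r, mul1r, mulr1, mulrN, mulrN1); zmod_cancel.
Qed.

Lemma brackets_jacobi t : homog X t ->
  ush t (fun a b => brackets ((tdeg a + 1, brackets a) :: b)) = 0.
Proof.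
move=> ht; pose z a := (tdeg a + 1, brackets a).
transitivity (ush t (fun a b => (brLprime (z a :: b), derU (z a :: b)))).
  apply: eq_ush => a b ab; apply: bracketsE.
  have [ha hb] := (homog_cat _ _).1 (homog_perm ab ht).
  by apply/homog_cons; split => //; apply: brackets_degree.
by rewrite ush_pairE; congr pair; [apply: jacobi_fst|apply: jacobi_snd].
Qed.

End DerivedJacobi.

(** * L-infinity algebras on lists *)

Section AdjacentSwaps.
Variable T : eqType.

(** Adjacent transpositions reach every rearrangement: a letter moves across a block, hence a block
    across a block. *)
Lemma perm_swap_ind (P : seq T -> Prop) :
  (forall s1 x y s2, P (s1 ++ x :: y :: s2) -> P (s1 ++ y :: x :: s2)) ->
  forall s t, perm_eq s t -> P s -> P t.
Proof.
move=> Psw.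
have move1 c x s r : P (c ++ s ++ x :: r) -> P (c ++ x :: s ++ r).
  elim: s c => [|y s IH] c //=; rewrite -cat_rcons => /IH.
  by rewrite cat_rcons => /Psw.
have moves c s2 s1 r : P (c ++ s1 ++ s2 ++ r) -> P (c ++ s2 ++ s1 ++ r).
  elim: s2 c => [|x s2 IH] c //=; move=> /move1; rewrite -cat_rcons => /IH.
  by rewrite cat_rcons.
by apply: catCA_perm_ind => s1 s2 s3; apply: (moves [::]).
Qed.

End AdjacentSwaps.

Section InversionsSwap.
Variables (K : comPzRingType) (n : nat) (e : 'I_n -> 'I_n -> K).
Hypotheses (eC : forall x y, e x y = e y x) (ee : forall x y, e x y * e x y = 1).

Lemma inversions_swap s1 x y s2 : x != y ->
  inversions e (s1 ++ x :: y :: s2) = e x y * inversions e (s1 ++ y :: x :: s2).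
Proof.
move=> xy; elim: s1 => [|z s1 IH] /=.
  rewrite !big_cons; case: (ltngtP x y) => [lt|lt|/val_inj e1]; last by rewrite e1 eqxx in xy.
    rewrite (eC y x) !mulrA ee mul1r -!mulrA [_ * (_ * inversions e s2)]mulrCA //.
  by rewrite -!mulrA; congr (_ * _); rewrite mulrCA.
rewrite IH mulrCA; congr (_ * (_ * _)).
by apply: perm_big; rewrite perm_cat2l -(cat1s x) -(cat1s y s2) perm_catCA.
Qed.

End InversionsSwap.

Section ListForm.
Variables (K : fieldType) (W : lmodType K).
Local Notation U := (int * W)%type.
Implicit Types (X : int -> set W) (l : seq U -> W) (s t a b : seq U) (u v : U).

Local Notation parU := (@parU K W).
Local Notation pars := (pars parU).
Local Notation ush := (ush parU).

(* The axioms of an L-infinity algebra with the Jacobi identity summed over all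
   unshuffles at once; [l [::] = 0] makes the unshuffles with empty first part
   contribute 0. *)
Record Linfty_lists X l : Prop := {
  lists_nil : l [::] = 0;
  lists_subspace : forall d, is_subspace (X d);
  lists_degree : forall s, homog X s -> X (tdeg s + 1) (l s);
  lists_multilinear : forall s1 s2 d (c : K) x y,
    homog X s1 -> homog X s2 -> X d x -> X d y ->
    l (s1 ++ (d, c *: x + y) :: s2) =
      c *: l (s1 ++ (d, x) :: s2) + l (s1 ++ (d, y) :: s2);
  lists_swap : forall s1 u v s2, homog X (s1 ++ u :: v :: s2) ->
    l (s1 ++ u :: v :: s2) =
      (-1) ^+ (parU u && parU v) *: l (s1 ++ v :: u :: s2);
  lists_jacobi : forall t, homog X t ->
    ush t (fun a b => l ((tdeg a + 1, l a) :: b)) = 0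
}.

Lemma koszulE n (t : n.-tuple U) (sg : 'S_n) :
  koszul t sg = inversions (pairsign K parU (tnth t)) (map sg (enum 'I_n)).
Proof.
rewrite -inversionsE; apply: eq_bigr => i _; apply: eq_bigr => j _.
by rewrite signz oddzM.
Qed.

Lemma permtE n (t : n.-tuple U) (sg : 'S_n) :
  permt t sg = map (tnth t) (map sg (enum 'I_n)) :> seq U.
Proof. by rewrite -map_comp. Qed.

Lemma lists_symmetric X l n (t : n.-tuple U) (sg : 'S_n) :
  Linfty_lists X l -> homog X t -> l t = koszul t sg *: l (permt t sg).
Proof.
move=> L ht; rewrite koszulE permtE.
pose e := pairsign K parU (tnth t).
(* Distinctness of the letters belongs to the invariant, since exchanging two equal ones would
   change no inversion. *)
pose P w := l t = inversions e w *: l (map (tnth t) w) /\ (uniq w /\ homog X (map (tnth t) w)).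
suff [//] : P (map sg (enum 'I_n)).
apply: (perm_swap_ind (P := P)) (enum 'I_n) _ _ _ => [s1 x y s2 [E [u h]]||].
- have pxy : perm_eq (s1 ++ x :: y :: s2) (s1 ++ y :: x :: s2).
    by rewrite perm_cat2l -(cat1s x) -(cat1s y s2) perm_catCA.
  split; last by split; [rewrite -(perm_uniq pxy)|apply: homog_perm h; rewrite perm_sym; apply: perm_map].
  have xy : x != y.
    by move: u; rewrite cat_uniq /= => /and3P[_ _ /andP[]]; rewrite inE; case: eqP.
  have eC x' y' : e x' y' = e y' x' by rewrite /e /pairsign andbC.
  have ee x' y' : e x' y' * e x' y' = 1 by rewrite -signr_addb addbb.
  rewrite E (inversions_swap eC ee _ _ xy) !map_cat /= (lists_swap L).
    by rewrite scalerA -/(e x y) mulrAC ee mul1r.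
  by rewrite map_cat in h.
- apply: uniq_perm; rewrite ?enum_uniq ?(map_inj_uniq (@perm_inj _ sg)) ?enum_uniq //.
  move=> x; rewrite mem_enum; apply/esym/mapP.
  by exists ((sg^-1)%g x); rewrite ?mem_enum ?permKV.
- rewrite /P inversions_sorted ?enum_ord_sorted // scale1r map_tnth_enum enum_uniq.
  by split.
Qed.

Lemma lists0 X l s1 d s2 : Linfty_lists X l -> homog X s1 -> homog X s2 ->
  l (s1 ++ (d, 0) :: s2) = 0.
Proof.
move=> L h1 h2; have [X0 _] := lists_subspace L d.
have := lists_multilinear L (-1) h1 h2 X0 X0.
by rewrite scaler0 addr0 scaleN1r addNr.
Qed.

Lemma Linfty_of_lists X l : Linfty_lists X l -> is_Linfty X l.
Proof.
move=> L; split.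
- exact: lists_subspace L.
- by move=> s _; apply: lists_degree L s.
- exact: lists_multilinear L.
- by move=> n t sg _; apply: lists_symmetric.
move=> n t n0 ht; rewrite /Linfty_relation.
pose Phi a b := l ((tdeg a + 1, l a) :: b).
transitivity (\sum_(1 <= i < n.+1) ush t (fun a b => if size a == i then Phi a b else 0)).
  apply: eq_big_nat => i /andP[_ ilt]; rewrite -(shuffle_ush parU t Phi (ilt : (i <= n)%N)).
  apply: eq_bigr => sg _; rewrite permtE -(map_comp (tnth t) sg) /Phi.
  congr (_ *: _); apply: eq_bigr => a _; apply: eq_bigr => b _.
  by rewrite signz oddzM.
rewrite -ush_sum -[RHS](lists_jacobi L ht); apply: eq_ush => a b ab.
have [_ hb] := (homog_cat _ _).1 (homog_perm ab ht).
(* The sum starts at [i = 1] and omits the empty inner part, which contributes 0 by [lists_nil];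
   every other unshuffle is counted once, at [i = size a]. *)
case: (posnP (size a)) => [/size0nil ->|a0].
  rewrite (lists_nil L) (lists0 (s1 := [::]) _ L) // big1_seq // => i /=.
  by rewrite mem_index_iota; case: i.
have an : (size a < n.+1)%N.
  by rewrite ltnS -(size_tuple t) -(perm_size ab) size_cat leq_addr.
rewrite (big_cat_nat (n := size a)) ?(ltnW an) //= [X in _ + X]big_ltn // eqxx.
rewrite !big1_seq ?add0r ?addr0 // => i /=; rewrite mem_index_iota => /andP[i1 i2].
  by rewrite ltn_eqF.
by rewrite gtn_eqF.
Qed.

End ListForm.

(** * Twisting *)

Local Open Scope classical_set_scope.
Local Open Scope ring_scope.

Section FiniteSums.
Variable M : zmodType.

Lemma sum_trunc (F : nat -> M) m n :
  (forall i, (m <= i)%N -> F i = 0) -> (forall i, (n <= i)%N -> F i = 0) ->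
  \sum_(i < m) F i = \sum_(i < n) F i.
Proof.
move=> Fm Fn; wlog mn : m n Fm Fn / (m <= n)%N.
  by move=> H; case: (leqP m n) => [|/ltnW] mn; [|symmetry]; apply: H.
rewrite (big_ord_widen n _ mn) big_mkcond; apply: eq_bigr => i _.
by case: ltnP => // /Fm.
Qed.

Lemma fsum_trunc (F : nat -> M) n (A : set nat) :
  (forall i, (n <= i)%N -> F i = 0) -> (forall i, ~ A i -> F i = 0) ->
  \sum_(i \in A) F i = \sum_(i < n) F i.
Proof.
move=> Fn FA; rewrite fsbig_mkcond fsbig_ord [RHS]fsbig_mkcond.
apply: eq_fsbigr => i _; rewrite /patch.
case: ifPn => [_|/negP iA]; case: ifPn => // /negP.
  by rewrite inE /= => /negP; rewrite -leqNgt => /Fn.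
by move=> _; rewrite FA // => Ai; apply: iA; rewrite inE.
Qed.

Lemma finite_support (F : nat -> M) n (A : set nat) :
  (forall i, (n <= i)%N -> F i = 0) -> finite_set [set i | A i /\ F i <> 0].
Proof.
move=> Fn; apply: (sub_finite_set (B := `I_n)); last exact: finite_II.
by move=> i /= [_ Fi]; rewrite ltnNge; apply/negP => /Fn.
Qed.

End FiniteSums.

Section BinomialSums.
Variables (K : fieldType) (charK0 : has_pchar0 K) (M : lmodType K).

Lemma pascal_sum (G : nat -> nat -> M) n :
  \sum_(p < n.+1) 'C(n, p)%:R *: G p.+1 (n - p)%N +
  \sum_(p < n.+1) 'C(n, p)%:R *: G p (n - p).+1 =
  \sum_(p < n.+2) 'C(n.+1, p)%:R *: G p (n.+1 - p)%N :> M.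
Proof.
rewrite [RHS]big_ord_recl [X in _ + X]big_ord_recl !bin0 !subn0 addrCA; congr (_ + _).
under [RHS]eq_bigr => p _ do rewrite lift0 binS natrD scalerDl subSS.
rewrite big_split addrC; congr (_ + _).
rewrite [RHS]big_ord_recr /= bin_small // scale0r addr0.
by apply: eq_bigr => p _; rewrite /= subnSK.
Qed.

(** The product of two exponential series, with k = p + q. The vanishing assumptions allow the
    triangle p + q < n to be exchanged for the square p, q < m. *)
Lemma exp_sum (f : nat -> nat -> M) m n :
  (forall p q, (m <= p)%N -> f p q = 0) -> (forall p q, (m <= q)%N -> f p q = 0) ->
  (forall p q, (n <= p + q)%N -> f p q = 0) ->
  \sum_(k < n) (k`!%:R : K)^-1 *: \sum_(p < k.+1) 'C(k, p)%:R *: f p (k - p)%N =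
  \sum_(p < m) (p`!%:R : K)^-1 *: \sum_(q < m) (q`!%:R : K)^-1 *: f p q.
Proof.
move=> fm fm' fn; pose G p q := (p`!%:R : K)^-1 *: ((q`!%:R : K)^-1 *: f p q).
have fact0 k : (k`!%:R : K) != 0 by rewrite ((pcharf0P K).1 charK0) -lt0n fact_gt0.
transitivity (\sum_(k < n) \sum_(p < n | (p <= k)%N) G p (k - p)%N).
  apply: eq_bigr => k _; rewrite scaler_sumr.
  rewrite (big_ord_widen n (fun p => (k`!%:R : K)^-1 *: ('C(k, p)%:R *: f p (k - p)%N))) //.
  apply: eq_bigr => p pk; rewrite /G !scalerA; congr (_ *: _).
  rewrite -(bin_fact (pk : (p <= k)%N)) !natrM !invfM [LHS]mulrC mulVKf //.
  have := fact0 k; rewrite -(bin_fact (pk : (p <= k)%N)) natrM mulf_eq0.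
  by case/norP.
rewrite (exchange_big_dep xpredT) //=.
transitivity (\sum_(p < n) \sum_(q < n) G p q).
  apply: eq_bigr => p _.
  rewrite -(big_mkord (fun k => (p <= k)%N) (fun k => G p (k - p)%N)).
  rewrite (big_cat_nat (n := p)) ?(ltnW (ltn_ord p)) //=.
  rewrite big_nat_cond big_pred0 ?add0r; last first.
    by move=> i; rewrite ltnNge; case: (p <= i)%N; rewrite ?andbF.
  transitivity (\sum_(0 + p <= k < n | (p <= k)%N) G p (k - p)%N); first by rewrite add0n.
  rewrite big_addn.
  rewrite (eq_bigl xpredT) => [|i]; last by rewrite leq_addl.
  under eq_bigr => i _ do rewrite addnK.
  rewrite big_mkord; apply: (sum_trunc (F := G p)) => q hq; rewrite /G fn ?scaler0 //.
    by rewrite -leq_subLR.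
  exact: leq_trans hq (leq_addl _ _).
rewrite (sum_trunc (F := fun p => \sum_(q < n) G p q) (n := m)); first last.
- by move=> p hp; rewrite big1 // => q _; rewrite /G fm ?scaler0.
- by move=> p hp; rewrite big1 // => q _; rewrite /G fn ?scaler0 // (leq_trans hp) ?leq_addr.
apply: eq_bigr => p _; rewrite scaler_sumr; apply: (sum_trunc (F := G p)) => q hq.
  by rewrite /G fn ?scaler0 // (leq_trans hq) ?leq_addl.
by rewrite /G fm' ?scaler0.
Qed.

End BinomialSums.

Section Twisting.
Variables (K : fieldType) (charK0 : has_pchar0 K) (W : lmodType K).
Variables (X : int -> set W) (l : seq (int * W) -> W).
Local Notation U := (int * W)%type.
Implicit Types (s t a b : seq U) (u v : U).

Local Notation parU := (@parU K W).
Local Notation ush := (ush parU).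

Hypothesis L : Linfty_lists X l.

Lemma ush_nseq n u s (Phi : seq U -> seq U -> W) : parU u = false ->
  ush (nseq n u ++ s) Phi =
  \sum_(p < n.+1) 'C(n, p)%:R *:
    ush s (fun a b => Phi (nseq p u ++ a) (nseq (n - p) u ++ b)).
Proof.
move=> pu; elim: n Phi => [|n IH] Phi; first by rewrite big_ord1 scale1r.
rewrite /= pu !IH /=.
rewrite -(pascal_sum (fun p q => ush s (fun a b => Phi (nseq p u ++ a) (nseq q u ++ b)))).
congr (_ + _); apply: eq_bigr => p _; congr (_ *: _).
by apply: eq_ush => a b _; rewrite scale1r.
Qed.

Lemma move_even n u s1 v s2 : parU u = false ->
  homog X (s1 ++ nseq n u ++ v :: s2) ->
  l (s1 ++ nseq n u ++ v :: s2) = l (s1 ++ v :: nseq n u ++ s2).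
Proof.
move=> pu; elim: n s1 => [|n IH] s1 //= h.
rewrite -cat_rcons IH cat_rcons // (lists_swap L); last first.
  apply: homog_perm h; rewrite perm_cat2l /= perm_cons -cat1s -[v :: s2]cat1s.
  by rewrite perm_catCA.
by rewrite pu scale1r.
Qed.

Lemma homog_nseq n u : X u.1 u.2 -> homog X (nseq n u).
Proof. by move=> Xu v; rewrite mem_nseq => /andP[_ /eqP ->]. Qed.

(** [a] and [b] count the letters already expanded, which keeps the induction hypothesis
    applicable. *)
Lemma binomial_expand th th' (n a b : nat) : X 0 th -> X 0 th' ->
  l (nseq a (0, th) ++ nseq b (0, th') ++ nseq n (0, th + th')) =
  \sum_(p < n.+1) 'C(n, p)%:R *:
    l (nseq (a + p) (0, th) ++ nseq (b + (n - p)) (0, th')).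
Proof.
move=> h h'; elim: n a b => [|n IH] a b.
  by rewrite big_ord1 scale1r !addn0 cats0.
have [X0 Xlin] := lists_subspace L 0.
have hD : X 0 (th + th') by rewrite -[th]scale1r; apply: Xlin.
rewrite /= catA -[th in X in l (_ ++ X :: _)]scale1r (lists_multilinear L) //; last first.
- exact: homog_nseq.
- by apply/homog_cat; split; apply: homog_nseq.
rewrite scale1r -!catA move_even //; last first.
  apply/homog_cat; split; first exact: homog_nseq.
  apply/homog_cat; split; first exact: homog_nseq.
  by apply/homog_cons; split=> //; apply: homog_nseq.
have nseqr m (x : U) r : nseq m x ++ x :: r = nseq m.+1 x ++ r.
  by elim: m => //= m ->.
rewrite !nseqr !IH.
rewrite -(pascal_sum (fun p q => l (nseq (a + p) (0, th) ++ nseq (b + q) (0, th')))).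
by congr (_ + _); apply: eq_bigr => p _; rewrite ?addSnnS.
Qed.

(** A derived bracket of n entries takes one element of C^{d+1|0} and brackets it with n - 1
    elements of a, so it vanishes once d + 3 < n; hence the 4. The sum of absolute degrees also
    bounds the degree of an inner bracket. *)
Definition degree_bound s : nat := (\sum_(u <- s) `|u.1|%N).+4.

Lemma degree_bound_cat s t : (degree_bound s <= degree_bound (s ++ t))%N.
Proof. by rewrite /degree_bound big_cat !ltnS leq_addr. Qed.

Lemma degree_bound_perm s t : perm_eq s t -> degree_bound s = degree_bound t.
Proof. by move=> st; rewrite /degree_bound (perm_big _ st). Qed.

Variable th : W.
Hypotheses (Xth : X 0 th)
  (l_bound : forall s i, homog X s -> (degree_bound s <= i)%N ->
     l (nseq i (0, th) ++ s) = 0).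

Let tw := twist l th.

Lemma twist_term_bound s i : homog X s -> (degree_bound s <= i)%N ->
  twist_term l th s i = 0.
Proof. by move=> hs si; rewrite /twist_term l_bound // scaler0. Qed.

Lemma twistE s n : homog X s -> (degree_bound s <= n)%N ->
  tw s = \sum_(i < n) (i`!%:R : K)^-1 *: l (nseq i (0, th) ++ s).
Proof.
move=> hs sn; apply: (fsum_trunc (F := twist_term l th s)) => [i ni|i []//].
by rewrite twist_term_bound // (leq_trans sn).
Qed.

Lemma homog_nseq_cat n s : homog X s -> homog X (nseq n (0, th) ++ s).
Proof. by move=> hs; apply/homog_cat; split=> //; apply: homog_nseq. Qed.

Lemma tdeg_nseq n s : tdeg (nseq n (0, th) ++ s) = tdeg s.
Proof. by elim: n => //= n IH; rewrite tdeg_cons add0r. Qed.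

Lemma subspace_sum d n (F : 'I_n -> W) (c : 'I_n -> K) :
  (forall i, X d (F i)) -> X d (\sum_(i < n) c i *: F i).
Proof.
move=> XF; have [X0 Xlin] := lists_subspace L d.
apply: (big_ind (X d)) => [//|x y Xx Xy|i _]; first by rewrite -[x]scale1r; apply: Xlin.
by rewrite -[_ *: _]addr0; apply: Xlin.
Qed.

Lemma twist_degree s : homog X s -> X (tdeg s + 1) (tw s).
Proof.
move=> hs; rewrite (twistE hs (leqnn _)); apply: subspace_sum => i.
rewrite -(tdeg_nseq i); apply: lists_degree L _ _; exact: homog_nseq_cat.
Qed.

Lemma l_sum s1 d s2 n (c : 'I_n -> K) (F : 'I_n -> W) :
  homog X s1 -> homog X s2 -> (forall i, X d (F i)) ->
  l (s1 ++ (d, \sum_(i < n) c i *: F i) :: s2) =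
  \sum_(i < n) c i *: l (s1 ++ (d, F i) :: s2).
Proof.
move=> h1 h2; elim: n c F => [|n IH] c F XF; first by rewrite !big_ord0 (lists0 _ L).
rewrite !big_ord_recl (lists_multilinear L) ?IH //; exact: subspace_sum.
Qed.

Lemma twist_jacobi t : homog X t ->
  ush t (fun a b => tw ((tdeg a + 1, tw a) :: b)) = 0.
Proof.
(* One more than the bound of [t], since the inner bracket enters with degree [tdeg a + 1]. *)
move=> ht; pose n := (degree_bound t).+1.
pose Phi a b := l ((tdeg a + 1, l a) :: b).
(* [p] counts the copies of [th] inside the inner bracket, [q] those outside. *)
pose f p q := ush t (fun a b => Phi (nseq p (0, th) ++ a) (nseq q (0, th) ++ b)).
have tdeg_abs a : (`|tdeg a| <= \sum_(u <- a) `|u.1|)%N.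
  elim: a => [|u a IH]; first by rewrite tdeg_nil big_nil.
  by rewrite tdeg_cons big_cons; lia.
have bound_a a b : perm_eq (a ++ b) t -> (degree_bound a <= n)%N.
  by move=> ab; rewrite /n -(degree_bound_perm ab) leqW // degree_bound_cat.
have bound_b a b (x : W) : perm_eq (a ++ b) t ->
    (degree_bound (((tdeg a + 1)%R, x) :: b) <= n)%N.
  move=> ab; rewrite /n -(degree_bound_perm ab) /degree_bound big_cons big_cat /=.
  by have := tdeg_abs a; lia.
have even : parU (0, th) = false by [].
have Phi_move p q a b : homog X a -> homog X b ->
    Phi (nseq p (0, th) ++ a) (nseq q (0, th) ++ b) =
    l (nseq q (0, th) ++ (tdeg a + 1, l (nseq p (0, th) ++ a)) :: b).
  move=> ha hb; rewrite /Phi tdeg_nseq (move_even (s1 := [::])) //.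
  apply: homog_nseq_cat; apply/homog_cons; split=> //.
  rewrite /= -(tdeg_nseq p); exact: (lists_degree L (homog_nseq_cat ha)).
transitivity (\sum_(p < n) (p`!%:R : K)^-1 *: \sum_(q < n) (q`!%:R : K)^-1 *: f p q).
  rewrite /f; under [RHS]eq_bigr => p _ do under eq_bigr => q _ do rewrite -ushZ.
  under [RHS]eq_bigr => p _ do rewrite -ush_sum -ushZ.
  rewrite -ush_sum; apply: eq_ush => a b ab.
  have [ha hb] := (homog_cat _ _).1 (homog_perm ab ht).
  have hab : homog X ((tdeg a + 1, tw a) :: b).
    by apply/homog_cons; split => //; apply: twist_degree.
  rewrite (twistE hab (bound_b _ _ _ ab)) (twistE ha (bound_a _ _ ab)).
  under eq_bigr => q _.
    rewrite l_sum //; [rewrite scaler_sumr; over|exact: homog_nseq|move=> p].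
    rewrite /= -(tdeg_nseq p); exact: (lists_degree L (homog_nseq_cat ha)).
  rewrite exchange_big; apply: eq_bigr => p _ /=; rewrite scaler_sumr.
  apply: eq_bigr => q _; rewrite Phi_move // !scalerA mulrC //.
have fp p q : (n <= p)%N -> f p q = 0.
  move=> np; rewrite /f -[RHS](ush0 parU W t); apply: eq_ush => a b ab.
  have [ha hb] := (homog_cat _ _).1 (homog_perm ab ht).
  rewrite Phi_move // (l_bound ha (leq_trans (bound_a _ _ ab) np)).
  by rewrite (lists0 _ L) //; apply: homog_nseq.
have fq p q : (n <= q)%N -> f p q = 0.
  move=> nq; rewrite /f -[RHS](ush0 parU W t); apply: eq_ush => a b ab.
  have [ha hb] := (homog_cat _ _).1 (homog_perm ab ht).
  rewrite Phi_move // l_bound ?(leq_trans (bound_b _ _ _ ab)) //.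
  apply/homog_cons; split=> //.
  rewrite /= -(tdeg_nseq p); exact: (lists_degree L (homog_nseq_cat ha)).
(* If p + q is at least n + n, then p or q is at least n. The regrouped sum collects the terms with
   [k] copies of [th] in all, which form one instance of the untwisted identity. *)
rewrite -(exp_sum charK0 (n := n + n) fp) //; last first.
  move=> p q npq; case: (leqP n p) => [/fp //|pn]; apply: fq; lia.
rewrite big1 // => k _; rewrite /f -(ush_nseq _ _ Phi even).
by rewrite (lists_jacobi L) ?scaler0 //; apply: homog_nseq_cat.
Qed.

(** The value on the empty list is the curvature of the twisted structure, that is, the
    Maurer-Cartan sum of [th]. [twist_jacobi] includes the empty inner bracket, which drops out when
    the curvature is 0. *)
Lemma twist_Linfty : tw [::] = 0 -> Linfty_lists X tw.
Proof.
move=> tw0; split=> //.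
- exact: lists_subspace L.
- exact: twist_degree.
- move=> s1 s2 d c x y h1 h2 hx hy.
  have hom z : X d z -> homog X (s1 ++ (d, z) :: s2).
    by move=> hz; apply/homog_cat; split=> //; apply/homog_cons.
  have bd z : degree_bound (s1 ++ (d, z) :: s2) = degree_bound (s1 ++ (d, 0) :: s2).
    by rewrite /degree_bound !big_cat !big_cons.
  have [X0 Xlin] := lists_subspace L d.
  rewrite !(twistE (n := degree_bound (s1 ++ (d, 0) :: s2))) ?bd //;
    try by apply: hom => //; apply: Xlin.
  rewrite scaler_sumr -big_split; apply: eq_bigr => i _ /=.
  rewrite !catA (lists_multilinear L) //; last exact: homog_nseq_cat.
  by rewrite scalerDr !scalerA mulrC.
- move=> s1 u v s2 h.
  have p : perm_eq (s1 ++ v :: u :: s2) (s1 ++ u :: v :: s2).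
    by rewrite perm_cat2l -[v :: _]cat1s -[u :: s2]cat1s perm_catCA.
  rewrite (twistE h (leqnn _)) (twistE (homog_perm p h) (eq_leq (degree_bound_perm p))).
  rewrite scaler_sumr; apply: eq_bigr => i _; rewrite !catA (lists_swap L).
    by rewrite !scalerA mulrC.
  by rewrite -catA; apply: homog_nseq_cat.
- exact: twist_jacobi.
Qed.

Lemma twist_summable s : homog X s -> fin_summable [set: nat] (twist_term l th s).
Proof.
move=> hs; apply: (finite_support (n := degree_bound s)) => i.
exact: twist_term_bound.
Qed.

Variable th' : W.
Hypotheses (Xth' : X 0 th')
  (l_bound' : forall p q, (4 <= p + q)%N -> l (nseq p (0, th) ++ nseq q (0, th')) = 0).

(** Copies of [th] come from the twist, copies of [th'] from the Maurer-Cartan sum, and the two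
    exponential series multiply to that of [th + th']. *)
Lemma MC_twist : tw [::] = 0 ->
  maurer_cartan X tw th' <->
  \sum_(k < 4) (k`!%:R : K)^-1 *: l (nseq k (0, th + th')) = 0.
Proof.
move=> tw0; have hq q : homog X (nseq q (0, th')) by apply: homog_nseq.
have bq q : degree_bound (nseq q (0, th')) = 4.
  by rewrite /degree_bound big_nseq; elim: q => //= q ->.
have MC4 k : (4 <= k)%N -> MC_term tw th' k = 0.
  move=> k4; rewrite /MC_term (twistE (hq k) (eq_leq (bq k))) big1 ?scaler0 // => i _.
  by rewrite l_bound' ?scaler0 // (leq_trans k4) ?leq_addl.
have MC0 k : ~ (1 <= k)%N -> MC_term tw th' k = 0.
  by case: k => // _; rewrite /MC_term tw0 scaler0.
have -> : \sum_(k < 4) (k`!%:R : K)^-1 *: l (nseq k (0, th + th')) =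
          \sum_(k \in [set k | (1 <= k)%N]) MC_term tw th' k.
  rewrite (fsum_trunc MC4 MC0).
  transitivity (\sum_(k < 4) (k`!%:R : K)^-1 *: \sum_(p < k.+1) 'C(k, p)%:R *:
      l (nseq p (0, th) ++ nseq (k - p) (0, th'))).
    apply: eq_bigr => k _; congr (_ *: _).
    by rewrite (binomial_expand k 0 0 Xth Xth').
  pose f p q := l (nseq p (0, th) ++ nseq q (0, th')).
  rewrite (exp_sum charK0 (f := f) (m := 4)); last exact: l_bound'.
  - rewrite /MC_term; under [RHS]eq_bigr => k _ do
      rewrite (twistE (hq k) (eq_leq (bq k))) scaler_sumr.
    rewrite exchange_big; apply: eq_bigr => p _; rewrite scaler_sumr.
    by apply: eq_bigr => q _; rewrite !scalerA mulrC.
  - by move=> p q hp; apply: l_bound'; rewrite (leq_trans hp) ?leq_addr.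
  - by move=> p q hp; apply: l_bound'; rewrite (leq_trans hp) ?leq_addl.
split=> [[]//|e]; split=> //.
exact: finite_support MC4.
Qed.

End Twisting.

(** * Relative Rota-Baxter Leibniz algebras *)

Section ExtractEntries.
Variables (K : fieldType) (W M : lmodType K).
Local Notation U := (int * W)%type.
Local Notation parU := (@parU K W).
Local Notation extract := (extract parU).
Implicit Types (s r : seq U) (u v : U) (Phi : U -> seq U -> M).

Lemma extract_multilinear s1 s2 d c (x y : W) Phi :
  (forall r, perm_eq r (s1 ++ s2) ->
    Phi (d, c *: x + y) r = c *: Phi (d, x) r + Phi (d, y) r) ->
  (forall u r1 r2, perm_eq (u :: r1 ++ r2) (s1 ++ s2) ->
    Phi u (r1 ++ (d, c *: x + y) :: r2) =
      c *: Phi u (r1 ++ (d, x) :: r2) + Phi u (r1 ++ (d, y) :: r2)) ->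
  extract (s1 ++ (d, c *: x + y) :: s2) Phi =
    c *: extract (s1 ++ (d, x) :: s2) Phi + extract (s1 ++ (d, y) :: s2) Phi.
Proof.
elim: s1 Phi => [|p s1 IH] Phi /= H1 H2.
  rewrite H1 // scalerDr addrACA -extractZ -extractD; congr (_ + _).
  apply: eq_extract => u r ur; rewrite (H2 u [::] r) //= scalerDr.
  by rewrite !scalerA mulrC.
rewrite H2 // IH => [|r r12|u r1 r2 ur].
- by rewrite !scalerDr addrACA.
- by rewrite H1 ?perm_cons // scalerDr !scalerA mulrC.
- rewrite (H2 u (p :: r1) r2) ?scalerDr ?scalerA 1?mulrC //=.
  by rewrite -[u :: _]cat1s -[p :: _ ++ _]cat1s perm_catCA perm_cons.
Qed.

Lemma extract_swap s1 u v s2 Phi :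
  (forall w r1 r2, perm_eq (w :: r1 ++ r2) (s1 ++ s2) ->
    Phi w (r1 ++ u :: v :: r2) =
      (-1) ^+ (parU u && parU v) *: Phi w (r1 ++ v :: u :: r2)) ->
  extract (s1 ++ u :: v :: s2) Phi =
    (-1) ^+ (parU u && parU v) *: extract (s1 ++ v :: u :: s2) Phi.
Proof.
elim: s1 Phi => [|p s1 IH] Phi H /=.
  rewrite !scalerDr scalerA -signr_addb [parU v && _]andbC addbb scale1r addrCA.
  congr (_ + (_ + _)); rewrite -extractZ; apply: eq_extract => w r wr.
  rewrite (H w [::] r) //= !scalerA -!signr_addb; congr (_ ^+ nat_of_bool _ *: _).
  by case: (parU u) (parU v) (parU w) => [] [] [].
rewrite H // scalerDr IH // => w r1 r2 wr; rewrite (H w (p :: r1) r2) /=.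
  by rewrite !scalerA mulrC.
by rewrite -[w :: _]cat1s -[p :: _ ++ _]cat1s perm_catCA perm_cons.
Qed.

End ExtractEntries.

(** * The derived brackets as an L-infinity algebra, and their Maurer-Cartan equation *)

Section BracketsLinfty.
Variables (K : fieldType) (charK0 : has_pchar0 K) (g V : lmodType K).
Local Notation E := (g * V)%type.
Local Notation C := (seq E -> E).
Local Notation W := (C * C)%type.
Local Notation U := (int * W)%type.
Local Notation X := (@Lshift K g V).
Implicit Types (q : C) (s t r a b : seq U) (p u v : U).

Local Notation parU := (@parU K W).

Lemma Lshift_subspace d : is_subspace (X d).
Proof.
split=> [|c x y [x1 x2] [y1 y2]]; first by split; apply: bideg0.
by split; apply: bideg_linear.
Qed.

Lemma iterbr_cat q s t : iterbr q (s ++ t) = iterbr (iterbr q s) t.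
Proof. by rewrite /iterbr map_cat foldl_cat. Qed.

Lemma iterbr_multilinear k l q s1 s2 d c (x y : W) : bideg k l q ->
  homog X s1 -> homog X s2 ->
  iterbr q (s1 ++ (d, c *: x + y) :: s2) =
    c *: iterbr q (s1 ++ (d, x) :: s2) + iterbr q (s1 ++ (d, y) :: s2).
Proof.
move=> bq h1 h2; rewrite !iterbr_cat !iterbr_cons.
by rewrite balavoine_linearr ?iterbr_linear //; apply: bideg_multilinear (iterbr_bideg bq h1).
Qed.

Lemma brLprime_multilinear s1 s2 d c (x y : W) :
  homog X s1 -> homog X s2 ->
  brLprime (s1 ++ (d, c *: x + y) :: s2) =
    c *: brLprime (s1 ++ (d, x) :: s2) + brLprime (s1 ++ (d, y) :: s2).
Proof.
rewrite !brLprimeE; case: s1 => [|p [|p' [|? ?]]]; case: s2 => [|u [|? ?]] //=;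
  rewrite ?scaler0 ?addr0 //.
- move=> _ /homog_cons[hu _]; rewrite /br2 /= balavoine_linearl ?scalerDr ?scalerA 1?mulrC //.
  exact: bideg_multilinear (homog_bidegL hu).
- move=> /homog_cons[hp _] _; rewrite /br2 /= balavoine_linearr ?scalerDr ?scalerA 1?mulrC //.
  exact: bideg_multilinear (homog_bidegL hp).
Qed.

Lemma brackets_multilinear s1 s2 d c (x y : W) :
  homog X s1 -> homog X s2 -> X d x -> X d y ->
  brackets (s1 ++ (d, c *: x + y) :: s2) =
    c *: brackets (s1 ++ (d, x) :: s2) + brackets (s1 ++ (d, y) :: s2).
Proof.
move=> h1 h2 hx hy; have hom z : X d z -> homog X (s1 ++ (d, z) :: s2).
  by move=> hz; apply/homog_cat; split=> //; apply/homog_cons.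
have hz : X d (c *: x + y) by have [_] := Lshift_subspace d; apply.
have h12 : homog X (s1 ++ s2) by apply/homog_cat.
rewrite !bracketsE; try exact: hom.
apply: (congr2 pair); first exact: brLprime_multilinear.
apply: extract_multilinear => [r rs|u r1 r2 ur].
  by rewrite /= iterbr_linear ?projP_linear //; apply: homog_perm h12.
have [hu hr] := (homog_cons _ _).1 (homog_perm ur h12).
have [hr1 hr2] := (homog_cat _ _).1 hr.
by rewrite (iterbr_multilinear _ _ _ _ (homog_bidegL hu)) // projP_linear.
Qed.

Lemma brackets_swap s1 u v s2 : homog X (s1 ++ u :: v :: s2) ->
  brackets (s1 ++ u :: v :: s2) =
    (-1) ^+ (parU u && parU v) *: brackets (s1 ++ v :: u :: s2).
Proof.
move=> h; have p : perm_eq (s1 ++ v :: u :: s2) (s1 ++ u :: v :: s2).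
  by rewrite perm_cat2l -[v :: _]cat1s -[u :: s2]cat1s perm_catCA.
have [h1 /homog_cons[hu /homog_cons[hv h2]]] := (homog_cat _ _).1 h.
rewrite !bracketsE //; last exact: homog_perm p h.
apply: (congr2 pair); first rewrite /= !brLprimeE.
  case: s1 {h p h1} => [|? [|? s1]] /=; try by case: s1 => [|? ?]; rewrite /= ?scaler0.
    case: s2 {h2} => [|? ?]; last by rewrite scaler0.
    by rewrite [RHS]/= (br2C hu hv) scalerA -signr_addb addbb scale1r.
  by rewrite scaler0.
apply: extract_swap => w r1 r2 wr.
have h12 : homog X (s1 ++ s2) by apply/homog_cat.
have [hw /homog_cat[hr1 hr2]] := (homog_cons _ _).1 (homog_perm wr h12).
rewrite (iterbr_swap (homog_bidegL hw)) ?projPZ //.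
by apply/homog_cat; split=> //; apply/homog_cons; split=> //; apply/homog_cons.
Qed.

Lemma brackets_lists : Linfty_lists X (@brackets K g V).
Proof.
split.
- exact: brackets_nil.
- exact: Lshift_subspace.
- exact: brackets_degree.
- exact: brackets_multilinear.
- exact: brackets_swap.
- exact: brackets_jacobi.
Qed.

(** The other entries each lower the first bidegree of the chosen L' element by 1, from d + 1 to
    below -1; three entries are too many for [brLprime]. *)
Lemma brackets_bound s : homog X s -> (3 <= size s)%N ->
  (forall u, u \in s -> u.1 + 3 < (size s)%:Z) -> brackets s = 0.
Proof.
move=> hs s3 us; rewrite bracketsE //; apply: (congr2 pair).
  by rewrite brLprimeE; case: (s) s3 => [|? [|? [|? ?]]].
rewrite /derU -[RHS](extract0 parU C s); apply: eq_extract => u r ur.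
have [hu hr] := (homog_cons _ _).1 (homog_perm ur hs).
have usz : u.1 + 3 < (size r).+1%:Z.
  by rewrite -[(size r).+1]/(size (u :: r)) (perm_size ur) us // -(perm_mem ur) mem_head.
rewrite (bideg_lt _ (iterbr_bideg (homog_bidegL hu) hr)) ?projP0 //.
have arith (d : int) (n : nat) : d + 3 < n.+1%:Z -> d + 1 - n%:Z < -1 by lia.
exact: arith usz.
Qed.

Lemma degree_le s u : u \in s -> u.1 <= (\sum_(v <- s) `|v.1|%N)%:Z.
Proof.
move=> us; rewrite (perm_big _ (perm_to_rem us)) big_cons /=; lia.
Qed.

Lemma brackets_nseq_bound (th : W) s i : X 0 th -> homog X s ->
  (degree_bound s <= i)%N -> brackets (nseq i (0, th) ++ s) = 0.
Proof.
rewrite /degree_bound => hth hs; set S := (\sum_(u <- s) _)%N => si.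
apply: brackets_bound.
- by apply/homog_cat; split=> //; apply: homog_nseq.
- by rewrite size_cat size_nseq; lia.
- move=> u; rewrite size_cat size_nseq mem_cat mem_nseq => /orP[/andP[_ /eqP ->]|us] /=.
    by lia.
  by have := degree_le us; rewrite -/S; lia.
Qed.

Lemma brackets_nseq2_bound (th th' : W) (p q : nat) : X 0 th -> X 0 th' -> (4 <= p + q)%N ->
  brackets (nseq p (0, th) ++ nseq q (0, th')) = 0.
Proof.
move=> h h' pq; apply: brackets_bound.
- by apply/homog_cat; split; apply: homog_nseq.
- by rewrite size_cat !size_nseq; lia.
- move=> u; rewrite size_cat !size_nseq mem_cat !mem_nseq.
  by case/orP=> /andP[_ /eqP ->] /=; lia.
Qed.

Lemma brackets_MC (rho T : C) : X 0 (rho, T) ->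
  \sum_(k < 4) (k`!%:R : K)^-1 *: brackets (nseq k (0, (rho, T))) = 0 <->
  balavoine rho rho = 0 /\ projP (balavoine (balavoine rho T) T) = 0.
Proof.
move=> h; have [br bT] := (homog_bidegL h, homog_bidegA h).
have hn n : homog X (nseq n (0, (rho, T))) by apply: homog_nseq.
(* [rho, T] has bidegree 0|1, which P kills. *)
have P1 : projP (balavoine rho T) = 0.
  by apply: projP_ker (balavoine_bideg br bT).
have B1 : brackets (nseq 1 (0, (rho, T))) = 0.
  rewrite (bracketsE (hn 1%N)); apply: (congr2 pair) => //.
  by rewrite /derU /= addr0; apply: projP_ker (homog_bidegL h).
have B2 : brackets (nseq 2 (0, (rho, T))) = (- balavoine rho rho, 0).
  rewrite (bracketsE (hn 2%N)); apply: (congr2 pair).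
    have -> : brLprime (nseq 2 (0, (rho, T))) = (-1) ^+ true *: balavoine rho rho.
      by rewrite brLprimeE.
    by rewrite expr1 scaleN1r.
  rewrite /derU /= addr0 expr0 scale1r.
  by have -> : iterbr rho [:: (0, (rho, T))] = balavoine rho T by []; rewrite P1 addr0.
(* The three choices of the entry supplying [rho] give equal terms, so the final coefficient is 3 /
   3! = 1 / 2. *)
have B3 : brackets (nseq 3 (0, (rho, T))) =
    (0, projP (balavoine (balavoine rho T) T) *+ 3).
  rewrite (bracketsE (hn 3%N)); apply: (congr2 pair) => //.
  by rewrite /derU /= addr0 !expr0 !scale1r.
have natK n : (n.+1%:R : K) != 0 by rewrite ((pcharf0P K).1 charK0).
rewrite [X in X = 0](_ : _ =
    ((2%:R : K)^-1 *: - balavoine rho rho,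
     (2%:R : K)^-1 *: projP (balavoine (balavoine rho T) T))); last first.
  rewrite !big_ord_recr /= big_ord0 B1 B2 B3 brackets_nil !scaler0 !add0r.
  apply: (congr2 pair) => /=; first by rewrite scaler0 addr0.
  rewrite scaler0 add0r -scaler_nat scalerA; congr (_ *: _).
  have -> : (3`! = 2 * 3)%N by [].
  by rewrite natrM invfM mulfVK.
split=> [[/eqP e1 /eqP e2]|[-> ->]]; last by rewrite oppr0 !scaler0.
move: e1 e2; rewrite !scaler_eq0 !invr_eq0 (negbTE (natK 1%N)) /= oppr_eq0.
by move=> /eqP -> /eqP ->.
Qed.

End BracketsLinfty.

(** * Degree 0 elements and the axioms of an rRB Leibniz algebra *)

Section RotaBaxterElements.
Variables (K : fieldType) (charK0 : has_pchar0 K) (g V : lmodType K).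
Local Notation E := (g * V)%type.
Local Notation C := (seq E -> E).
Local Notation W := (C * C)%type.
Local Notation X := (@Lshift K g V).

Lemma bilinear_exists (A B D : lmodType K) (f : A -> B -> D) :
  (forall c x x' y, f (c *: x + x') y = c *: f x y + f x' y) ->
  (forall c x y y', f x (c *: y + y') = c *: f x y + f x y') ->
  exists h : {bilinear A -> B -> D}, forall x y, h x y = f x y.
Proof.
move=> fl fr.
have bf : bilinear_for (GRing.Scale.Law.clone _ _ *:%R _)
    (GRing.Scale.Law.clone _ _ *:%R _) f.
  by split=> [y c x x'|x c y y'] /=; [apply: fl|apply: fr].
pose h : {bilinear A -> B -> D} :=
  HB.pack f (bilinear_isBilinear.Build K A B D _ _ f bf).
by exists h.
Qed.

Lemma linear_exists (A B : lmodType K) (f : A -> B) :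
  (forall c x y, f (c *: x + y) = c *: f x + f y) ->
  exists h : {linear A -> B}, forall x, h x = f x.
Proof.
move=> lf; pose h : {linear A -> B} := HB.pack f (GRing.isLinear.Build K A B _ f lf).
by exists h.
Qed.

(** The bidegree leaves [rho] its components on the words gg, gV and Vg and leaves [T] its component
    on V, from which multilinearity recovers both. So [defines_rRB] comes down to the axioms for
    degree 0 elements. *)
Lemma Lshift0_rRB_element (w : W) : X 0 w ->
  exists (mu : {bilinear g -> g -> g}) (lV : {bilinear g -> V -> V})
         (rV : {bilinear V -> g -> V}) (R : {linear V -> g}),
    w = rRB_element mu lV rV R.
Proof.
case: w => rho T [[_ [rho0 rholin] rhob] [_ [T0 Tlin] Tb]]; simpl in *.
have inD (x x' : g) (c : K) : (c *: x + x', 0 : V) = c *: (x, 0) + (x', 0) :> E.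
  by apply: (congr2 pair); rewrite //= scaler0 addr0.
have inV (v v' : V) (c : K) : (0 : g, c *: v + v') = c *: (0, v) + (0, v') :> E.
  by apply: (congr2 pair); rewrite //= scaler0 addr0.
have [mu muE] := @bilinear_exists g g g (fun x y => (rho [:: (x, 0); (y, 0)]).1)
  ltac:(by move=> c x x' y /=; rewrite inD (rholin [::]))
  ltac:(by move=> c x y y' /=; rewrite inD (rholin [:: _] [::])).
have [lV lE] := @bilinear_exists g V V (fun x v => (rho [:: (x, 0); (0, v)]).2)
  ltac:(by move=> c x x' y /=; rewrite inD (rholin [::]))
  ltac:(by move=> c x y y' /=; rewrite inV (rholin [:: _] [::])).
have [rV rE] := @bilinear_exists V g V (fun v x => (rho [:: (0, v); (x, 0)]).2)
  ltac:(by move=> c x x' y /=; rewrite inV (rholin [::]))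
  ltac:(by move=> c x y y' /=; rewrite inD (rholin [:: _] [::])).
have [R RE] := @linear_exists V g (fun v => (T [:: (0, v)]).1)
  ltac:(by move=> c x y /=; rewrite inV (Tlin [::] [::])).
have split_E (x : E) : x = 1 *: (x.1, 0) + (0, x.2) :> E.
  by rewrite scale1r [RHS]surjective_pairing /= addr0 add0r; case: (x).
exists mu, lV, rV, R; apply: (congr2 pair); apply/funext.
  case=> [|x [|y [|z s]]] /=; try exact: rho0.
  have rl1 c z z' s : rho ((c *: z + z') :: s) = c *: rho (z :: s) + rho (z' :: s).
    exact: (rholin [::]).
  have rl2 c z z' z0 : rho [:: z0; c *: z + z'] = c *: rho [:: z0; z] + rho [:: z0; z'].
    exact: (rholin [:: z0] [::]).
  rewrite [in LHS](split_E x) [in LHS](split_E y) rl1 !rl2 !scale1r.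
  have [gg _ _] := rhob [:: inl x.1; inl y.1].
  have [_ gv _] := rhob [:: inl x.1; inr y.2].
  have [_ vg _] := rhob [:: inr x.2; inl y.1].
  have [_ _ vv] := rhob [:: inr x.2; inr y.2].
  rewrite /= in gg gv vg vv; rewrite vv // addr0 muE lE rE.
  rewrite [LHS]surjective_pairing /= gg // gv // vg // !add0r !addr0 //.
case=> [|x [|z s]] /=; try exact: T0.
have Tl c z z' : T [:: c *: z + z'] = c *: T [:: z] + T [:: z'].
  exact: (Tlin [::] [::]).
rewrite [in LHS](split_E x) Tl scale1r RE.
have [_ _ tg] := Tb [:: inl x.1]; have [tv _ _] := Tb [:: inr x.2].
rewrite /= in tg tv; rewrite tg // add0r [LHS]surjective_pairing tv //.
Qed.

Lemma MC_rRB (mu : {bilinear g -> g -> g}) (lV : {bilinear g -> V -> V})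
    (rV : {bilinear V -> g -> V}) (R : {linear V -> g}) :
  \sum_(k < 4) (k`!%:R : K)^-1 *: brackets (nseq k (0, rRB_element mu lV rV R)) = 0
  <-> rRB_leibniz mu lV rV R.
Proof.
have X0 := rRB_element_degree0 mu lV rV R; rewrite (brackets_MC charK0 X0).
set rho := lift_structure mu lV rV; set T := lift_operator R.
have crho : is_cochain 2 rho by exact: bideg_cochain (homog_bidegL X0).
have cT : is_cochain 1 T by exact: bideg_cochain (homog_bidegA X0).
have cb := balavoine_cochain crho cT.
have natK n : (n.+1%:R : K) != 0 by rewrite ((pcharf0P K).1 charK0).
(* Both conditions come out doubled: [rho, rho] is twice rho <> rho, and the two copies of [T]
   produce every term twice. *)
have two_inj (D : lmodType K) (z : D) : z + z = 0 -> z = 0.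
  move=> zz; apply: (scalerI (natK 1%N)); by rewrite scaler0 scaler_nat mulr2n.
have leibnizE : balavoine rho rho = 0 <-> leibniz_algebra mu /\ leibniz_rep mu lV rV.
  (* The first component is the defect of the Leibniz identity. In the second, an argument from V in
     the third, second or first place yields the three axioms of a representation, in this order. *)
  have insE x y z : ins true rho rho [:: x; y; z] =
      (mu (mu x.1 y.1) z.1 + mu y.1 (mu x.1 z.1) - mu x.1 (mu y.1 z.1),
       (lV (mu x.1 y.1) z.2 + rV (lV x.1 y.2 + rV x.2 y.1) z.1) +
       (lV y.1 (lV x.1 z.2 + rV x.2 z.1) + rV y.2 (mu x.1 z.1)) -
       (lV x.1 (lV y.1 z.2 + rV y.2 z.1) + rV x.2 (mu y.1 z.1))).
    rewrite /= !expr1 !expr0 !scaler0 !addr0 !add0r !scale1r !scaleN1r.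
    by apply: (congr2 pair); rewrite /= ?subr0.
  have -> : balavoine rho rho = 0 <-> forall x y z, ins true rho rho [:: x; y; z] = 0.
    rewrite (balavoine_ins crho crho) -[odd 1]/true expr1 opprK; split=> [e x y z|e].
      by apply: two_inj; have := congr1 (fun F => F [:: x; y; z]) e; rewrite scale1r.
    apply/funext => s; rewrite scale1r.
    case: (eqVneq (size s) 3) => [|s3]; last by rewrite (ins_size crho crho s3) addr0.
    by case: s => [|x [|y [|z []]]] // _; rewrite e addr0.
  split=> [J|[leib [rep1 rep2 rep3]] x y z].
    split=> [x y z|].
      have := congr1 fst (J (x, 0) (y, 0) (z, 0)); rewrite insE /= => e.
      by apply/esym/eqP; rewrite -subr_eq0 e.
    split=> [x y v|x y v|x y v].
    - have := congr1 snd (J (x, 0) (y, 0) (0, v)); rewrite insE /=.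
      rewrite !(linear0l, linear0r, addr0, add0r) => e.
      by apply/esym/eqP; rewrite -subr_eq0 e.
    - have := congr1 snd (J (x, 0) (0, v) (y, 0)); rewrite insE /=.
      rewrite !(linear0l, linear0r, addr0, add0r) => e.
      by apply/esym/eqP; rewrite -subr_eq0 e.
    - have := congr1 snd (J (0, v) (x, 0) (y, 0)); rewrite insE /=.
      rewrite !(linear0l, linear0r, addr0, add0r) => e.
      by apply/esym/eqP; rewrite -subr_eq0 e.
  rewrite insE; apply: (congr2 pair) => /=; first by rewrite (leib x.1) subrr.
  rewrite !(linearDl, linearDr) (rep1 x.1) (rep2 x.1) (rep3 y.1); zmod_cancel.
have rbE : projP (balavoine (balavoine rho T) T) = 0 <-> rota_baxter mu lV rV R.
  have -> : projP (balavoine (balavoine rho T) T) = 0 <->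
      forall v v', (balavoine (balavoine rho T) T [:: (0, v); (0, v')]).1 = 0.
    have cbT := balavoine_cochain cb cT.
    split=> [e v v'|e].
      by have := congr1 (fun F => (F [:: (0, v); (0, v')]).1) e.
    apply/funext => s; rewrite /projP.
    case: (eqVneq (size s) 2) => [|s2].
      by case: s => [|x [|y []]] // _; rewrite /= e.
    by rewrite (cochain_size cbT) // size_map.
  have valueE v v' : (balavoine (balavoine rho T) T [:: (0, v); (0, v')]).1 =
      (mu (R v) (R v') - R (lV (R v) v' + rV v (R v'))) +
      (mu (R v) (R v') - R (lV (R v) v' + rV v (R v'))).
    rewrite (balavoine_ins cb cT) (balavoine_ins crho cT) /=.
    rewrite !(linear0, linear0l, linear0r, expr0, expr1, scale1r, scaleN1r, scaler0,
      oppr0, addr0, add0r).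
    have RD a b : R (a + b) = R a + R b by exact: linearD.
    rewrite !RD; zmod_cancel.
  split=> [e v v'|e v v']; last by rewrite valueE e subrr addr0.
  by apply/eqP; rewrite -subr_eq0; apply/eqP/two_inj; rewrite -valueE.
rewrite leibnizE rbE; split=> [[[]]|[]]; by split.
Qed.

End RotaBaxterElements.

Theorem theorem3p14 (K : fieldType) (charK0 : has_pchar0 K)
    (g V : lmodType K)
    (mu : {bilinear g -> g -> g}) (lV : {bilinear g -> V -> V})
    (rV : {bilinear V -> g -> V}) (R : {linear V -> g})
    (rRB : rRB_leibniz mu lV rV R) :
  let theta := rRB_element mu lV rV R in
  let l := @brackets K g V in
  let X := @Lshift K g V in
  ((forall s, s <> [::] -> homog X s ->
      fin_summable [set: nat] (twist_term l theta s)) /\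
   is_Linfty X (twist l theta)) /\
  (forall theta', X 0 theta' ->
     (defines_rRB (theta + theta') <->
      maurer_cartan X (twist l theta) theta')).
Proof.
move=> theta l X.
have Xtheta : X 0 theta by exact: rRB_element_degree0.
have L : Linfty_lists X l by exact: brackets_lists.
have bound s i : homog X s -> (degree_bound s <= i)%N -> l (nseq i (0, theta) ++ s) = 0.
  exact: brackets_nseq_bound.
(* The given rRB structure enters here, as the vanishing of the curvature. *)
have tw0 : twist l theta [::] = 0.
  rewrite (twistE bound (n := 4)) //; last by rewrite /degree_bound big_nil.
  under eq_bigr => i _ do rewrite cats0.
  exact/(MC_rRB charK0).
split; first split.
- by move=> s _ hs; exact: (twist_summable bound hs).
- exact: (Linfty_of_lists (twist_Linfty charK0 L Xtheta bound tw0)).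
move=> theta' Xtheta'.
rewrite (MC_twist charK0 L Xtheta bound Xtheta' _ tw0); last first.
  by move=> p q; apply: brackets_nseq2_bound.
split=> [[mu' [lV' [rV' [R' [-> H]]]]]|]; first exact/(MC_rRB charK0).
have XD : X 0 (theta + theta').
  by rewrite -[theta]scale1r; have [_] := lists_subspace L 0; apply.
have [mu' [lV' [rV' [R' ->]]]] := Lshift0_rRB_element XD.
by move=> /(MC_rRB charK0) H; exists mu', lV', rV', R'.
Qed.
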